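(* Let $A$ be a finite abelian group, $\chi$ a non-degenerate symmetric bicharacter of $A$, $\tau$ a square root of $|A|^{-1}$, and let $\mathcal{C}=\mathcal{TY}(A,\chi,\tau)$ with its canonical pivotal structure. (a) Frobenius theorem holds for $\mathcal{C}$ if $|A|\equiv1\pmod4$. (b) Frobenius theorem does not hold for $\mathcal{C}$ if $|A|\equiv3\pmod4$. In fact, in this case $\nu_2(\mathcal{C})$ is not divisible by two (i.e. $\nu_2(\mathcal{C})/2$ is not an algebraic integer).
   Context: Everything is over $\mathbb{C}$; groups are written multiplicatively. A bicharacter of $A$ is a map $\chi: A\times A\to\mathbb{C}^\times$ multiplicative in each variable; it is symmetric if $\chi(a,b)=\chi(b,a)$, and non-degenerate if $\chi(x,a)=1$ for all $x\in A$ implies $a=1$. For a pivotal fusion category $\mathcal{C}$, $\nu_n(\mathcal{C})=\sum_{V\in\mathrm{Irr}(\mathcal{C})}\nu_n(V)\,\mathrm{pdim}(V)$, where $\mathrm{Irr}(\mathcal{C})$ is a set of representatives of the isomorphism classes of simple objects and $\mathrm{pdim}$ is the pivotal dimension. If the global dimension $\dim(\mathcal{C})$ is a positive integer, we say that Frobenius theorem holds for $\mathcal{C}$ if $\nu_n(\mathcal{C})/n$ is an algebraic integer for every positive integer $n$ dividing $\dim(\mathcal{C})$. For $\mathcal{C}=\mathcal{TY}(A,\chi,\tau)$: $\mathrm{Irr}(\mathcal{C})=A\sqcup\{m\}$, $\mathrm{pdim}(a)=1$ for $a\in A$, $\mathrm{pdim}(m)=\sqrt{|A|}$, and $\dim(\mathcal{C})=2|A|$.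 Tambara-Yamagami category. $\mathcal{TY}(A,\chi,\tau)$ (with $\tau\in\mathbb{R}$, $\tau^2=|A|^{-1}$) is the skeletal $\mathbb{C}$-linear monoidal category whose objects are finite direct sums of elements of $S=A\sqcup\{m\}$, with $\mathrm{Hom}(s,s')=\mathbb{C}$ if $s=s'$ and $0$ otherwise ($s,s'\in S$) and the obvious composition. The tensor product is $a\otimes b=ab$, $a\otimes m=m=m\otimes a$, $m\otimes m=\bigoplus_{x\in A}x$ ($a,b\in A$). The unit object is $1\in A$ with identity unit constraints. The associativity constraint $\Phi_{X,Y,Z}:(X\otimes Y)\otimes Z\to X\otimes(Y\otimes Z)$ is determined by $\Phi_{a,m,b}=\chi(a,b)\,\mathrm{id}_m$, $\Phi_{m,a,m}=(\chi(a,x)\delta_{x,y}\mathrm{id}_x)_{x,y}:\bigoplus_x x\to\bigoplus_y y$, $\Phi_{m,m,m}=(\tau\chi(x,y)^{-1}\mathrm{id}_m)_{x,y}:\bigoplus_{x\in A}m\to\bigoplus_{y\in A}m$, all other $\Phi_{s,t,u}$ ($s,t,u\in S$) being identities. The left dual of $a\in A$ is $a^{-1}$ with identity coevaluation and evaluation; the left dual of $m$ is $m$ with coevaluation the injection $1\to m\otimes m$ and evaluation $\tau^{-1}p$, where $p:m\otimes m\to1$ is the projection. The bidual functor is the identity, and the canonical pivotal structure is $j_a=\mathrm{id}_a$ ($a\in A$), $j_m=\mathrm{sgn}(\tau)\,\mathrm{id}_m$. Frobenius-Schur indicators. Let $\mathcal{C}$ be a $\mathbb{C}$-linear rigid monoidal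 category with pivotal structure $j:\mathrm{id}\to(-)^{**}$, coevaluations $d_V:1\to V\otimes V^*$ and evaluations $b_V:V^*\otimes V\to 1$. Put $V^{\otimes0}=1$, $V^{\otimes 1}=V$, $V^{\otimes n}=V\otimes V^{\otimes(n-1)}$ for $n\ge2$. Let $A^X_{Y,Z}:\mathrm{Hom}(X,Y\otimes Z)\to\mathrm{Hom}(Y^*\otimes X,Z)$ and $B^{X,Y}_Z:\mathrm{Hom}(X\otimes Y,Z)\to\mathrm{Hom}(X,Z\otimes Y^* )$ be the standard duality isomorphisms (up to associativity, $f\mapsto(b_Y\otimes\mathrm{id}_Z)(\mathrm{id}_{Y^*}\otimes f)$ and $g\mapsto(g\otimes\mathrm{id}_{Y^*})(\mathrm{id}_X\otimes d_Y)$). Define the linear automorphism $E_V^{(n)}$ of $\mathrm{Hom}(1,V^{\otimes n})$ by $E_V^{(n)}(f)=\Phi\circ(\mathrm{id}_{V^{\otimes(n-1)}}\otimes j_V^{-1})\circ B^{1,V^*}_{V^{\otimes(n-1)}}(A^1_{V,V^{\otimes(n-1)}}(f))$, where $\Phi:V^{\otimes(n-1)}\otimes V\to V^{\otimes n}$ is the associativity isomorphism. The $n$-th Frobenius-Schur indicator is $\nu_n(V)=\mathrm{Tr}(E_V^{(n)})$. *)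

(* Defs.v *)
From HB Require Import structures.
From mathcomp Require Import all_boot all_order all_algebra all_fingroup.
From mathcomp Require Import complex reals.

Set Implicit Arguments.
Unset Strict Implicit.
Unset Printing Implicit Defensive.

Import Order.TTheory GRing.Theory Num.Theory.

Local Open Scope ring_scope.
Local Open Scope complex_scope.

(* The structure maps of a K-linear rigid monoidal category with a pivotal
   structure.  Only data is recorded, not the coherence axioms: the invariants
   below are expressions in these maps alone.  [hcomp g f] is g o f, and
   [assoc X Y Z] goes from (X Y) Z to X (Y Z). *)
Record pivotal_data (K : fieldType) := PivotalData {
  obj : Type;
  hom : obj -> obj -> vectType K;
  idhom : forall X, hom X X;
  hcomp : forall X Y Z, hom Y Z -> hom X Y -> hom X Z;
  unit_obj : obj;
  tens : obj -> obj -> obj;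
  tensm : forall X X' Y Y', hom X X' -> hom Y Y' -> hom (tens X Y) (tens X' Y');
  assoc : forall X Y Z, hom (tens (tens X Y) Z) (tens X (tens Y Z));
  assocV : forall X Y Z, hom (tens X (tens Y Z)) (tens (tens X Y) Z);
  lunit : forall X, hom (tens unit_obj X) X;
  lunitV : forall X, hom X (tens unit_obj X);
  runit : forall X, hom (tens X unit_obj) X;
  runitV : forall X, hom X (tens X unit_obj);
  ldual : obj -> obj;
  ev : forall X, hom (tens (ldual X) X) unit_obj;
  coev : forall X, hom unit_obj (tens X (ldual X));
  piv : forall X, hom X (ldual (ldual X));
  pivV : forall X, hom (ldual (ldual X)) X
}.

Arguments unit_obj {K p}.
Arguments idhom {K p} X.
Arguments hcomp {K p X Y Z}.
Arguments assoc {K p} X Y Z.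
Arguments assocV {K p} X Y Z.
Arguments lunit {K p} X.
Arguments lunitV {K p} X.
Arguments runit {K p} X.
Arguments runitV {K p} X.
Arguments ev {K p} X.
Arguments coev {K p} X.
Arguments piv {K p} X.
Arguments pivV {K p} X.

Local Notation "X ** Y" := (tens X Y) (at level 40, left associativity).
Local Notation "f *** g" := (tensm f g) (at level 40, left associativity).
Local Notation "g \oc f" := (hcomp g f) (at level 50, left associativity).

Definition end_trace (K : fieldType) (V : vectType K) (E : V -> V) : K :=
  \sum_(i < \dim {:V}) coord (vbasis {:V}) i (E (vbasis {:V})`_i).

Section Indicators.
Variables (K : fieldType) (C : pivotal_data K).
Implicit Types (X Y Z V : obj C).

(* Right-nested, with V^0 = 1 and V^1 = V (not V ** 1). *)
Fixpoint tpow V (n : nat) : obj C :=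
  match n with
  | 0 => unit_obj
  | k.+1 => match k with 0 => V | _.+1 => V ** tpow V k end
  end.

(* V^(n+1) -> V ** V^n : the identity, except for n = 0 where it is the right
   unit constraint. *)
Definition tpow_split V n : hom (tpow V n.+1) (V ** tpow V n) :=
  match n return hom (tpow V n.+1) (V ** tpow V n) with
  | 0 => runitV V
  | k.+1 => idhom (V ** tpow V k.+1)
  end.

Fixpoint assoc_pow V n : hom (tpow V n ** V) (tpow V n.+1) :=
  match n return hom (tpow V n ** V) (tpow V n.+1) with
  | 0 => lunit V
  | k.+1 =>
      match k return hom (tpow V k ** V) (tpow V k.+1) ->
                     hom (tpow V k.+1 ** V) (tpow V k.+2) with
      | 0 => fun=> idhom (V ** V)
      | l.+1 => fun Phi => (idhom V *** Phi) \oc assoc V (tpow V l.+1) V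
      end (assoc_pow V k)
  end.

Definition dualA X Y Z (f : hom X (Y ** Z)) : hom (ldual Y ** X) Z :=
  lunit Z \oc (ev Y *** idhom Z) \oc assocV (ldual Y) Y Z
  \oc (idhom (ldual Y) *** f).

Definition dualB X Y Z (g : hom (X ** Y) Z) : hom X (Z ** ldual Y) :=
  (g *** idhom (ldual Y)) \oc assocV X Y (ldual Y) \oc (idhom X *** coev Y)
  \oc runitV X.

(* [fs_rot V n] is the operator E_V^(n+1).  The identification of 1 ** V^* with
   V^* ** 1 between the two duality isomorphisms is made explicit. *)
Definition fs_rot V n (f : hom unit_obj (tpow V n.+1)) :
    hom unit_obj (tpow V n.+1) :=
  assoc_pow V n \oc (idhom (tpow V n) *** pivV V)
  \oc dualB (dualA (tpow_split V n \oc f)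
             \oc runitV (ldual V) \oc lunit (ldual V)).

(* Meaningful for n >= 1 only. *)
Definition fs_indicator V n : K := end_trace (@fs_rot V n.-1).

(* The endomorphism of 1 below is pdim V times the identity. *)
Definition pdim V : K :=
  coord [tuple idhom (@unit_obj K C)] ord0
    (ev (ldual V) \oc (piv V *** idhom (ldual V)) \oc coev V).

End Indicators.

Record fusion_data (K : fieldType) := FusionData {
  fcat :> pivotal_data K;
  Irr : finType;
  irr : Irr -> obj fcat
}.

Definition global_dim (K : fieldType) (C : fusion_data K) : K :=
  \sum_(s : Irr C) pdim (irr s) * pdim (ldual (irr s)).

Definition fs_total (K : fieldType) (C : fusion_data K) (n : nat) : K :=
  \sum_(s : Irr C) fs_indicator (irr s) n * pdim (irr s).

Definition algebraic_integer (K : fieldType) (z : K) : Prop :=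
  integralOver (intr : int -> K) z.

Definition frobenius_holds (K : fieldType) (C : fusion_data K) : Prop :=
  exists N : nat, [/\ (0 < N)%N, global_dim C = N%:R &
    forall n : nat, (0 < n)%N -> (n %| N)%N ->
      algebraic_integer (fs_total C n / n%:R)].

Section Bicharacters.
Variables (K : fieldType) (gT : finGroupType) (chi : gT -> gT -> K).

Definition bicharacter : Prop :=
  [/\ forall a b, chi a b != 0,
      forall a b c, chi (a * b)%g c = chi a c * chi b c &
      forall a b c, chi a (b * c)%g = chi a b * chi a c].

Definition bichar_symmetric : Prop := forall a b, chi a b = chi b a.

Definition bichar_nondegenerate : Prop :=
  forall a, (forall x, chi x a = 1) -> a = 1%g.

End Bicharacters.

(* The simple labels: [Some a] is the element a of A, [None] is m. *)
Definition ty_label (gT : finGroupType) := option gT.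

(* [ty_fuses s t u]: u occurs (with multiplicity one) in s ** t. *)
Definition ty_fuses (gT : finGroupType) (s t u : ty_label gT) : bool :=
  match s, t, u with
  | Some a, Some b, Some c => c == (a * b)%g
  | Some _, None, None | None, Some _, None | None, None, Some _ => true
  | _, _, _ => false
  end.

(* A finite direct sum of simple objects. *)
Record ty_obj (gT : finGroupType) := TYObj {
  ty_idx : finType;
  ty_lab : ty_idx -> ty_label gT
}.

Section TambaraYamagami.
Variables (R : realType) (gT : finGroupType).
Variables (chi : gT -> gT -> R[i]) (tau : R).

Local Notation label := (ty_label gT).
Local Notation tyobj := (ty_obj gT).
Local Notation lab := ty_lab.
Implicit Types (X Y Z : tyobj).

Definition ty_simple (s : label) : tyobj := TYObj (fun _ : unit => s).

(* Morphisms are matrices supported on the pairs of summands with the same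
   label. *)
Definition ty_pair X Y := {p : ty_idx X * ty_idx Y | lab p.1 == lab p.2}.

Definition ty_hom X Y : vectType R[i] := {ffun ty_pair X Y -> R[i]^o}.

Definition ty_mor X Y (c : ty_idx X -> ty_idx Y -> R[i]) : ty_hom X Y :=
  [ffun p : ty_pair X Y => c (val p).1 (val p).2].

Definition ty_entry X Y (f : ty_hom X Y) (i : ty_idx X) (j : ty_idx Y) : R[i] :=
  if insub (i, j) is Some p then f p else 0.

Definition ty_id X : ty_hom X X := ty_mor (fun i j => (i == j)%:R).

Definition ty_comp X Y Z (g : ty_hom Y Z) (f : ty_hom X Y) : ty_hom X Z :=
  ty_mor (fun i k => \sum_j ty_entry f i j * ty_entry g j k).

(* The summands of X ** Y are the triples of a summand i of X, a summand j of Y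
   and a simple u in (label of i) ** (label of j). *)
Definition ty_chan X Y :=
  {p : ty_idx X * ty_idx Y * label | ty_fuses (lab p.1.1) (lab p.1.2) p.2}.

Definition ty_tens X Y : tyobj :=
  TYObj (fun p : ty_chan X Y => (val p).2).

Definition lft X Y (p : ty_idx (ty_tens X Y)) : ty_idx X := (val p).1.1.
Definition rgt X Y (p : ty_idx (ty_tens X Y)) : ty_idx Y := (val p).1.2.

Definition ty_tensm X X' Y Y' (f : ty_hom X X') (g : ty_hom Y Y') :
    ty_hom (ty_tens X Y) (ty_tens X' Y') :=
  ty_mor (fun p q =>
    ty_entry f (lft p) (lft q) * ty_entry g (rgt p) (rgt q)).

Definition ty_unit : tyobj := ty_simple (Some 1%g).

(* [ty_F s t r p q u] is the coefficient of the associativity constraint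
   (s t) r -> s (t r) from the summand u of p r, with p in s t, to the summand u
   of s q, with q in t r; [ty_FV] is the one of its inverse. *)
Definition ty_F (s t r p q u : label) : R[i] :=
  match s, t, r, p, q, u with
  | Some a, None, Some b, _, _, _ => chi a b
  | None, Some a, None, _, _, Some x => chi a x
  | None, None, None, Some x, Some y, _ => tau%:C * (chi x y)^-1
  | _, _, _, _, _, _ => 1
  end.

Definition ty_FV (s t r p q u : label) : R[i] :=
  match s, t, r, p, q, u with
  | Some a, None, Some b, _, _, _ => (chi a b)^-1
  | None, Some a, None, _, _, Some x => (chi a x)^-1
  | None, None, None, Some x, Some y, _ => tau%:C * chi x y
  | _, _, _, _, _, _ => 1
  end.

Definition same_legs X Y Z (p : ty_idx (ty_tens (ty_tens X Y) Z))
    (q : ty_idx (ty_tens X (ty_tens Y Z))) : bool :=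
  [&& lft (lft p) == lft q, rgt (lft p) == lft (rgt q)
    & rgt p == rgt (rgt q)].

Definition ty_assoc X Y Z :
    ty_hom (ty_tens (ty_tens X Y) Z) (ty_tens X (ty_tens Y Z)) :=
  ty_mor (fun p q => (same_legs p q)%:R *
    ty_F (lab (lft q)) (lab (lft (rgt q))) (lab (rgt p))
         (lab (lft p)) (lab (rgt q)) (lab p)).

Definition ty_assocV X Y Z :
    ty_hom (ty_tens X (ty_tens Y Z)) (ty_tens (ty_tens X Y) Z) :=
  ty_mor (fun q p => (same_legs p q)%:R *
    ty_FV (lab (lft q)) (lab (lft (rgt q))) (lab (rgt p))
          (lab (lft p)) (lab (rgt q)) (lab p)).

(* In this encoding 1 ** X and X are not the same family but are canonically
   reindexed; these maps are the identity unit constraints. *)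
Definition ty_lunit X : ty_hom (ty_tens ty_unit X) X :=
  ty_mor (fun p i => (rgt p == i)%:R).
Definition ty_lunitV X : ty_hom X (ty_tens ty_unit X) :=
  ty_mor (fun i p => (rgt p == i)%:R).
Definition ty_runit X : ty_hom (ty_tens X ty_unit) X :=
  ty_mor (fun p i => (lft p == i)%:R).
Definition ty_runitV X : ty_hom X (ty_tens X ty_unit) :=
  ty_mor (fun i p => (lft p == i)%:R).

Definition dual_label (s : label) : label := omap (fun a => a^-1%g) s.

Definition ty_dual X : tyobj := TYObj (fun i => dual_label (lab (t := X) i)).

Definition ty_ev X : ty_hom (ty_tens (ty_dual X) X) ty_unit :=
  ty_mor (fun (p : ty_idx (ty_tens (ty_dual X) X)) _ =>
                     (lft p == rgt p :> ty_idx X)%:R *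
                     (if lab (rgt p) is None then (tau%:C)^-1 else 1)).

Definition ty_coev X : ty_hom ty_unit (ty_tens X (ty_dual X)) :=
  ty_mor (fun _ (p : ty_idx (ty_tens X (ty_dual X))) =>
            (lft p == rgt p :> ty_idx X)%:R).

Definition piv_scalar (s : label) : R[i] :=
  if s is None then (Num.sg tau)%:C else 1.

Definition ty_piv X : ty_hom X (ty_dual (ty_dual X)) :=
  ty_mor (fun (i : ty_idx X) (j : ty_idx (ty_dual (ty_dual X))) =>
            (i == j :> ty_idx X)%:R * piv_scalar (lab i)).

Definition ty_pivV X : ty_hom (ty_dual (ty_dual X)) X :=
  ty_mor (fun (i : ty_idx (ty_dual (ty_dual X))) (j : ty_idx X) =>
            (i == j :> ty_idx X)%:R * (piv_scalar (lab j))^-1).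

Definition ty_pivotal : pivotal_data R[i] :=
  @PivotalData R[i] tyobj ty_hom ty_id ty_comp ty_unit ty_tens ty_tensm
    ty_assoc ty_assocV ty_lunit ty_lunitV ty_runit ty_runitV
    ty_dual ty_ev ty_coev ty_piv ty_pivV.

Definition TY : fusion_data R[i] :=
  @FusionData R[i] ty_pivotal label ty_simple.

End TambaraYamagami.

(* The invariants of TY have the expected values: pdim m = |tau|^-1 = |A|^(1/2)
   and dim TY = 2|A|. *)
Section TYDimensions.
Variables (R : realType) (gT : finGroupType).
Variables (chi : gT -> gT -> R[i]) (tau : R).
Implicit Types (X Y : ty_obj gT).
Local Notation C := (TY chi tau).

Lemma ty_entry_mor X Y (c : ty_idx X -> ty_idx Y -> R[i]) i j :
  ty_entry (ty_mor c) i j = if ty_lab i == ty_lab j then c i j else 0.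
Proof.
rewrite /ty_entry; case: insubP => [p /= -> E|/= /negbTE-> //].
by move: E; rewrite ffunE /= => ->.
Qed.

Lemma ty_coord_unit (f : ty_hom R (ty_unit gT) (ty_unit gT)) :
  coord [tuple (ty_id R (ty_unit gT))] ord0 f = ty_entry f tt tt.
Proof.
have fr : free [tuple (ty_id R (ty_unit gT))].
  rewrite seq1_free; apply/eqP.
  move=> /(congr1 (fun g : ty_hom R (ty_unit gT) (ty_unit gT) =>
                     ty_entry g tt tt)).
  rewrite /= ty_entry_mor /= !eqxx /ty_entry.
  rewrite [insub _]insubT /= => [|h]; first by rewrite eqxx.
  by rewrite ffunE => /eqP; rewrite (oner_eq0 R[i]).
have E : f = ty_entry f tt tt *: ty_id R (ty_unit gT).
  apply/ffunP => -[[[] []] h]; rewrite !ffunE /= [RHS]mulr1 /ty_entry.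
  by rewrite insubT; congr (f _); apply: val_inj.
rewrite [in LHS]E linearZ /=.
have := coord_free ord0 ord0 fr; rewrite /= => ->.
by rewrite mulr1.
Qed.

Lemma ty_pdimE (s : ty_label gT) : tau != 0 ->
  pdim (irr (f:=C) s) = if s is None then `|tau|^-1%:C else 1.
Proof.
move=> tau0; rewrite /pdim [LHS]ty_coord_unit /= /ty_comp.
have H : ty_fuses s (dual_label s) (Some 1%g).
  by case: s => //= a; rewrite mulgV.
pose p0 : ty_idx (ty_tens (ty_simple s) (ty_dual (ty_simple s))) :=
  exist _ (tt, tt, Some 1%g) H.
rewrite ty_entry_mor /= (bigD1 p0) //= big1 ?addr0; last first.
  move=> [[[[] []] u] Hu] /= nq; rewrite ty_entry_mor /=.
  case: eqP => [e|_]; last by rewrite mulr0.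
  by case/eqP: nq; apply: val_inj; rewrite /= e.
rewrite !ty_entry_mor /= eqxx mul1r.
have H' : ty_fuses (dual_label (dual_label s)) (dual_label s) (Some 1%g).
  by case: s {H p0} => //= a; rewrite mulVg.
pose p1 : ty_idx (ty_tens (ty_dual (ty_dual (ty_simple s)))
                          (ty_dual (ty_simple s))) :=
  exist _ (tt, tt, Some 1%g) H'.
rewrite (bigD1 p1) //= big1 ?addr0; last first.
  move=> [[[[] []] u] Hu] /= nq; rewrite ty_entry_mor /=.
  case: eqP => [e|_]; last by rewrite mul0r.
  by case/eqP: nq; apply: val_inj; rewrite /= e.
rewrite !ty_entry_mor /= eqxx /lft /rgt /= !eqxx.
have -> : dual_label (dual_label s) = s.
  by case: s {H p0 H' p1} => //= a; rewrite invgK.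
rewrite eqxx /= !mul1r mulr1.
case: s {H p0 H' p1} => [a|] /=; first by rewrite mulr1.
rewrite -fmorphV -rmorphM /=; congr (_%:C).
rewrite -[in RHS](mulr_sg_norm tau) normrM normr_id normr_sg tau0 mul1r.
by rewrite -{2}(mulr_sg_norm tau) invfM mulrA divff ?mul1r // sgr_eq0.
Qed.

Lemma ty_global_dimE : tau ^+ 2 = #|gT|%:R^-1 ->
  global_dim C = (2 * #|gT|)%:R.
Proof.
move=> ht.
have t0 : tau != 0.
  apply/eqP => t0; move/eqP: ht; rewrite t0 expr0n /= eq_sym invr_eq0 pnatr_eq0.
  by apply/negP; rewrite -lt0n; apply/card_gt0P; exists 1%g.
rewrite /global_dim /=.
rewrite (eq_bigr (fun s : option gT => if s is None then #|gT|%:R else 1));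
  last first.
  move=> s _; rewrite ty_pdimE //.
  rewrite (ty_pdimE (dual_label s)) //.
  case: s => [a|] /=; first by rewrite mulr1.
  rewrite -rmorphM /= -invfM -normrM -expr2 ht normfV invrK normr_nat.
  by rewrite rmorph_nat.
rewrite (bigD1 None) //= (eq_bigl (fun s => s \in predC1 None)) //.
rewrite (eq_bigr (fun=> 1)) => [|[a|] //].
by rewrite sumr_const -natrD cardC1 card_option /= mul2n addnn.
Qed.

End TYDimensions.

(* Main.v *)
Require Import Defs.
From mathcomp Require Import all_boot all_order all_algebra all_fingroup.
From mathcomp Require Import all_solvable.
From mathcomp Require Import complex reals zify ring.

Set Implicit Arguments.
Unset Strict Implicit.
Unset Printing Implicit Defensive.

Import Order.TTheory GRing.Theory Num.Theory.

Local Open Scope ring_scope.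

(** Write A for the group, N for its order, m for the non-invertible simple
    object, A[k] for the group of a with a^k = 1, and [None], [Some a] for the
    labels of m and a.

    Indicators.  A summand of V^n (V simple) is a path of labels.  On the
    coefficients of a morphism 1 -> V^(n+1), the rotation E is the associativity
    isomorphism V^n V -> V^(n+1) up to a scalar ([fs_rot_entry]), so its trace
    is a sum over paths of diagonal entries of that isomorphism, and these are
    products of associativity coefficients along the path ([diag_coefS]).  Hence
    nu_n(a) = 1 or 0 according as a^n = 1 or not, nu_n(m) = 0 for n odd, and
    nu_(2k+2)(m) = sgn(tau) t_k(1), where t_0 = 1 and
    t_(k+1)(y) = tau sum_x chi(x,y) chi(x,x)^-1 t_k(x)
    ([fs_indicator_m_even]).

    Gauss sums.  For N odd put q(a) = chi(a,a)^(-(N+1)/2); this is a quadratic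
    form with q(ab) = q(a) q(b) chi(a,b)^-1.  Let G = sum_a q(a) and
    w = tau G.  Completing the square in the recursion ([transfer_iter]) gives
    nu_(2k)(C) = |A[2k]| + w^k sum_b q(b)^-k.  The function q^-k is constant on
    the cosets of A[k] and even, and inversion fixes only 1; so its sum is
    |A[k]| (1 + 2z) with z an algebraic integer ([sum_quadVX]).

    (a) Let N = 1 mod 4.  If n | 2N is odd, nu_n(C) = |A[n]| is divisible by n
    by Frobenius' theorem.  If n = 2k, then
    nu_n(C)/n = (|A[k]|/k) ((1 + w^k)/2 + w^k z), so it is enough that
    (1 + w)/2 is an algebraic integer, k being odd.  Now G = 1 + 2z' with z'
    integral, and N w^2 = G^2, so (w^2 - 1)/4 is integral as soon as w^2 is;
    and w^2 = G^2/N is a root of unity.  The last point comes from determinants: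
    with M the matrix of the bicharacter and D = diag(q), completing the square
    reads M D M = G D^-1 M' D^-1, where M' = M up to a permutation of the rows
    and M M' = N ([gauss_sum_sq_unity]).

    (b) Let N = 3 mod 4.  Then nu_2(C) = 1 + tau^-1 with tau^-2 = N, and if
    z = (1 + tau^-1)/2 were integral, so would be z^2 - z = (N - 1)/4, hence
    1/2. *)

(** * Algebraic integers *)

Section AlgebraicIntegers.
Variable K : numFieldType.
Implicit Types x y z : K.
Local Notation algint := (@algebraic_integer K).

Lemma algint_nat n : algint n%:R. Proof. exact: (integral_nat intr). Qed.
Lemma algint0 : algint 0. Proof. exact: (algint_nat 0). Qed.
Lemma algint1 : algint 1. Proof. exact: (algint_nat 1). Qed.

Lemma algintD x y : algint x -> algint y -> algint (x + y).
Proof. exact: (@integral_add _ _ intr). Qed.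

Lemma algintB x y : algint x -> algint y -> algint (x - y).
Proof. exact: (@integral_sub _ _ intr). Qed.

Lemma algintM x y : algint x -> algint y -> algint (x * y).
Proof. exact: (@integral_mul _ _ intr). Qed.

Lemma algintX x n : algint x -> algint (x ^+ n).
Proof.
move=> ax; elim: n => [|n IH]; first by rewrite expr0; exact: algint1.
by rewrite exprS; apply: algintM.
Qed.

Lemma algint_sum (I : finType) (P : pred I) (F : I -> K) :
  (forall i, P i -> algint (F i)) -> algint (\sum_(i | P i) F i).
Proof. by move=> aF; apply: big_ind => //; [exact: algint0|exact: algintD]. Qed.

Lemma algint_root (p : {poly int}) x :
  p \is monic -> root (map_poly intr p) x -> algint x.
Proof. by move=> mp rp; exists p. Qed.

Lemma algint_unity x n : (0 < n)%N -> x ^+ n = 1 -> algint x.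
Proof.
move=> n0 xn; apply: (@algint_root ('X^n - 1)); first exact: monicXnsubC.
by rewrite rmorphB /= map_polyXn rmorph1 rootE !hornerE xn subrr.
Qed.

Lemma algint_quadratic x : algint (x ^+ 2 - x) -> algint x.
Proof.
move=> ac; pose p : {poly K} := 'X^2 - 'X - (x ^+ 2 - x)%:P.
apply: (@integral_root_monic _ _ intr _ p).
- rewrite monicE /p -addrA -opprD lead_coefDl ?lead_coefXn //.
  rewrite size_polyN size_polyXn (leq_ltn_trans (size_polyD _ _)) //.
  by rewrite size_polyX gtn_max (leq_ltn_trans (size_polyC_leq1 _)).
- by rewrite rootE !hornerE subrr.
apply/(integral_poly intr) => i; rewrite !coefB coefXn coefX coefC.
apply: algintB; first by apply: algintB; exact: algint_nat.
by case: ifP => // _; exact: algint0.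
Qed.

Lemma half_not_algint : ~ algint 2%:R^-1.
Proof.
case=> p mp /rootP; rewrite horner_coef size_map_inj_poly ?rmorph0 //;
  last exact: intr_inj.
case d_eq: (size p) => [|d] e.
  by have := monic_neq0 mp; rewrite -size_poly_eq0 d_eq.
have : (\sum_(i < d.+1) p`_i * 2 ^+ (d - i))%:~R = 0 :> K.
  rewrite -[RHS](mulr0 (2%:R ^+ d)) -e rmorph_sum mulr_sumr.
  apply: eq_bigr => i _; rewrite coef_map /= intrM mulrCA; congr (_ * _).
  rewrite rmorphXn /= exprVn exprB ?unitfE ?pnatr_eq0 //.
  by rewrite -ltnS.
move=> /eqP; rewrite intr_eq0 big_ord_recr /= subnn mulr1.
have -> : p`_d = 1 by have /monicP := mp; rewrite lead_coefE d_eq.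
have -> : \sum_(i < d) p`_i * 2 ^+ (d - i) =
   2 * \sum_(i < d) p`_i * 2 ^+ (d - i.+1) :> int.
  rewrite mulr_sumr; apply: eq_bigr => i _.
  by rewrite mulrCA -exprS subnSK.
by move: (\sum_(_ < _) _) => z; lia.
Qed.

End AlgebraicIntegers.

(** * Bicharacters and quadratic Gauss sums *)

Lemma expg_card (gT : finGroupType) (a : gT) : (a ^+ #|gT| = 1)%g.
Proof. by rewrite -cardsT (expg_cardG (G := [set: gT])) ?inE. Qed.

Section BicharacterTheory.
Variables (K : numFieldType) (gT : finGroupType) (beta : gT -> gT -> K).
Hypothesis beta_bichar : bicharacter beta.

Lemma bichar_neq0 a b : beta a b != 0.
Proof. by case: beta_bichar. Qed.

Lemma bicharMl a b c : beta (a * b)%g c = beta a c * beta b c.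
Proof. by case: beta_bichar. Qed.

Lemma bicharMr a b c : beta a (b * c)%g = beta a b * beta a c.
Proof. by case: beta_bichar. Qed.

Lemma bichar1l b : beta 1%g b = 1.
Proof.
by apply: (mulfI (bichar_neq0 1%g b)); rewrite -bicharMl mulg1 mulr1.
Qed.

Lemma bichar1r a : beta a 1%g = 1.
Proof.
by apply: (mulfI (bichar_neq0 a 1%g)); rewrite -bicharMr mulg1 mulr1.
Qed.

Lemma bicharVl a b : beta a^-1%g b = (beta a b)^-1.
Proof.
apply: (mulfI (bichar_neq0 a b)).
by rewrite -bicharMl mulgV bichar1l mulfV // bichar_neq0.
Qed.

Lemma bicharVr a b : beta a b^-1%g = (beta a b)^-1.
Proof.
apply: (mulfI (bichar_neq0 a b)).
by rewrite -bicharMr mulgV bichar1r mulfV // bichar_neq0.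
Qed.

Lemma bicharXl a b n : beta (a ^+ n)%g b = beta a b ^+ n.
Proof.
elim: n => [|n IH]; first by rewrite bichar1l.
by rewrite expgS bicharMl IH exprS.
Qed.

Lemma bichar_unity a b : beta a b ^+ #|gT| = 1.
Proof.
by rewrite -bicharXl expg_card bichar1l.
Qed.

Hypothesis beta_nondeg : bichar_nondegenerate beta.

(** Orthogonality of characters. *)
Lemma bichar_sum a : \sum_b beta b a = #|gT|%:R *+ (a == 1%g).
Proof.
have [->|na] := eqVneq a 1%g.
  by rewrite (eq_bigr (fun=> 1)) ?sumr_const // => b _; rewrite bichar1r.
have [/existsP[x nx]|] := boolP [exists x, beta x a != 1]; last first.
  rewrite negb_exists => /forallP h; case/eqP: na; apply: beta_nondeg => x.
  by apply/eqP; have := h x; rewrite negbK.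
have x1 : beta x a - 1 != 0 by rewrite subr_eq0.
apply/eqP; rewrite mulr0n -(mulIr_eq0 _ (mulIf x1)).
rewrite mulrBr mulr1 subr_eq0 mulr_suml [X in _ == X](reindex_inj (mulIg x)) /=.
by apply/eqP/eq_bigr => b _; rewrite bicharMl.
Qed.

End BicharacterTheory.

(** [q] is an even quadratic form with associated bicharacter [beta], whose
    values are roots of unity. *)
Section GaussSum.
Variables (K : numFieldType) (gT : finGroupType) (beta : gT -> gT -> K).
Hypothesis beta_bichar : bicharacter beta.
Hypothesis beta_sym : bichar_symmetric beta.
Hypothesis beta_nondeg : bichar_nondegenerate beta.
Variable q : gT -> K.
Hypothesis qM : forall a b, q (a * b)%g = q a * q b * beta a b.
Hypothesis qV : forall a, q a^-1%g = q a.
Hypothesis q_unity : forall a, q a ^+ #|gT| = 1.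

Local Notation N := (#|gT|%:R : K).

Lemma finGroup_card_gt0 : (0 < #|gT|)%N.
Proof. by apply/card_gt0P; exists 1%g. Qed.

Lemma finGroup_card_neq0 : N != 0.
Proof. by rewrite pnatr_eq0 -lt0n finGroup_card_gt0. Qed.

Lemma quad_neq0 a : q a != 0.
Proof.
apply: contraTneq (oner_neq0 K) => qa.
by rewrite -(q_unity a) qa expr0n -(prednK finGroup_card_gt0) eqxx.
Qed.

Lemma quad1 : q 1%g = 1.
Proof.
apply: (mulfI (quad_neq0 1%g)).
by have := qM 1%g 1%g; rewrite mulg1 (bichar1l beta_bichar) !mulr1 => <-.
Qed.

Lemma bichar_diag a : beta a a = q a ^+ 2.
Proof.
have := qM a a^-1%g; rewrite mulgV quad1 qV (bicharVr beta_bichar) => e.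
by rewrite -[LHS]mul1r e divfK ?expr2 // bichar_neq0.
Qed.

(** The quadratic Gauss sum of [q]. *)
Definition gauss_sum := \sum_a q a.

Lemma complete_square c : \sum_b beta c b * q b = gauss_sum / q c.
Proof.
rewrite /gauss_sum [X in X / _](reindex_inj (mulgI c)) mulr_suml /=.
by apply: eq_bigr => b _; rewrite qM; field; exact: quad_neq0.
Qed.

Lemma gauss_sum_norm : gauss_sum * \sum_b (q b)^-1 = N.
Proof.
transitivity (\sum_b \sum_c beta b c * q c).
  by rewrite mulr_sumr; apply: eq_bigr => b _; rewrite complete_square.
rewrite exchange_big (bigD1 1%g) //= -mulr_suml (bichar_sum beta_bichar) //.
rewrite eqxx quad1 mulr1 big1 ?addr0 // => a /negbTE na.
by rewrite -mulr_suml (bichar_sum beta_bichar) // na mul0r.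
Qed.

Let n := #|gT|.
Let el (i : 'I_n) : gT := enum_val i.
Let idx (a : gT) : 'I_n := enum_rank a.

Let sum_el (F : gT -> K) : \sum_(i < n) F (el i) = \sum_a F a.
Proof.
apply/esym/reindex; exists idx => a _; first exact: enum_valK.
exact: enum_rankK.
Qed.

(** The identity M D M = G D^-1 M' D^-1 gives, on taking determinants, that
    (G^2 / N)^N is a root of unity: M and M' differ by the permutation matrix S
    of inversion, which has determinant of square 1, and M M' = N. *)
Lemma gauss_sum_sq_unity :
  exists2 m, (0 < m)%N & (gauss_sum ^+ 2 / N) ^+ m = 1.
Proof.
pose M : 'M[K]_n := \matrix_(i, j) beta (el i) (el j).
pose M' : 'M[K]_n := \matrix_(i, j) beta (el i)^-1%g (el j).
pose S : 'M[K]_n := \matrix_(i, j) (el j == (el i)^-1%g)%:R.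
pose D : 'M[K]_n := diag_mx (\row_i q (el i)).
pose D' : 'M[K]_n := diag_mx (\row_i (q (el i))^-1).
have eSM : S *m M = M'.
  apply/matrixP => i j; rewrite !mxE.
  under eq_bigr => k _ do rewrite !mxE.
  rewrite (sum_el (fun x => (x == (el i)^-1%g)%:R * beta x (el j))).
  rewrite (bigD1 (el i)^-1%g) //= eqxx mul1r big1 ?addr0 // => x /negbTE->.
  by rewrite mul0r.
have eSS : S *m S = 1%:M.
  apply/matrixP => i j; rewrite !mxE.
  under eq_bigr => k _ do rewrite !mxE.
  rewrite (sum_el (fun x => (x == (el i)^-1%g)%:R * (el j == x^-1%g)%:R)).
  rewrite (bigD1 (el i)^-1%g) //= eqxx mul1r big1 ?addr0 => [|x /negbTE->];
    last by rewrite mul0r.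
  by rewrite invgK (inj_eq enum_val_inj) eq_sym.
have eMM : M *m M' = N%:M.
  apply/matrixP => i j; rewrite !mxE.
  under eq_bigr => k _ do rewrite !mxE.
  rewrite (sum_el (fun x => beta (el i) x * beta x^-1%g (el j))).
  under eq_bigr => x _.
    rewrite beta_sym (bicharVl beta_bichar) -(bicharVr beta_bichar).
    rewrite -(bicharMr beta_bichar).
    over.
  rewrite (bichar_sum beta_bichar) // -eq_invg_mul (inj_eq invg_inj).
  by rewrite (inj_eq enum_val_inj).
have eMDM : M *m D *m M = gauss_sum *: (D' *m M' *m D').
  rewrite !mul_mx_diag mul_diag_mx; apply/matrixP => i j; rewrite !mxE.
  under eq_bigr => k _ do rewrite !mxE.
  rewrite (sum_el (fun x => beta (el i) x * q x * beta x (el j))).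
  under eq_bigr => x _.
    rewrite (beta_sym x) mulrAC -(bicharMl beta_bichar).
    over.
  rewrite complete_square qM (bicharVl beta_bichar) !invfM.
  by congr (_ * _); rewrite mulrAC.
pose d := \det M; pose t := \prod_a q a; pose e := \det S.
have detD : \det D = t.
  rewrite det_diag /t (reindex el).
    by apply: eq_bigr => i _; rewrite mxE.
  by exists idx => a _; [exact: enum_valK|exact: enum_rankK].
have detD' : \det D' = t^-1.
  rewrite det_diag -detD det_diag -prodfV.
  by apply: eq_bigr => i _; rewrite !mxE.
have e2 : e * e = 1 by rewrite -det_mulmx eSS det1.
have dM' : \det M' = e * d by rewrite -eSM det_mulmx.
have d2 : e * d ^+ 2 = N ^+ n.
  have := congr1 determinant eMM; rewrite det_mulmx det_scalar dM' => <-.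
  by rewrite -/d; ring.
have td0 : t != 0 by apply/prodf_neq0 => a _; exact: quad_neq0.
have d0 : d != 0.
  apply: contraTneq (expf_neq0 n finGroup_card_neq0) => d0.
  by rewrite -d2 d0 expr0n mulr0 eqxx.
have tn : t ^+ n = 1.
  by rewrite -prodrXl big1 // => a _; rewrite q_unity.
have main : d * t ^+ 3 = gauss_sum ^+ n * e.
  have := congr1 determinant eMDM.
  rewrite detZ !det_mulmx detD detD' dM' -/d => E.
  apply: (mulfI d0); transitivity (d * t * d * t ^+ 2); first by ring.
  by rewrite E; field.
exists (n * (n * 2))%N; first by rewrite !muln_gt0 finGroup_card_gt0.
have -> : (gauss_sum ^+ 2 / N) ^+ (n * (n * 2)) =
    (gauss_sum ^+ n ^+ 2 / N ^+ n) ^+ (n * 2).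
  by rewrite exprM expr_div_n exprAC.
have -> : gauss_sum ^+ n ^+ 2 / N ^+ n = e * t ^+ 6.
  have ed0 : e * d ^+ 2 != 0 by rewrite d2 expf_neq0 // finGroup_card_neq0.
  rewrite -d2; apply: (mulIf ed0); rewrite divfK //.
  have -> : gauss_sum ^+ n = d * t ^+ 3 * e.
    by rewrite main -mulrA e2 mulr1.
  by ring.
rewrite exprMn mulnC [in X in X * _]exprM expr2 e2 expr1n mul1r mulnC.
by rewrite -exprM mulnCA exprM tn expr1n.
Qed.

End GaussSum.

(** * Sums over an abelian group of odd order *)

Section OddGroup.
Variables (K : numFieldType) (gT : finGroupType).
Hypothesis abelian_gT : abelian [set: gT].
Hypothesis odd_gT : odd #|gT|.

Lemma invg_fix (a : gT) : a^-1%g = a -> a = 1%g.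
Proof.
move=> aa; have a2 : (a ^+ 2 = 1)%g by rewrite expgS expg1 -{1}aa mulVg.
have := expg_card a; rewrite -[#|gT|]odd_double_half odd_gT expgD expg1.
by rewrite -mul2n expgM a2 expg1n mulg1.
Qed.

(** Inversion has 1 as its only fixed point, so the other terms come in equal
    pairs. *)
Lemma sum_paired (g : gT -> K) :
  (forall a, algebraic_integer (g a)) -> (forall a, g a^-1%g = g a) ->
  exists2 z, algebraic_integer z & \sum_a g a = g 1%g + 2%:R * z.
Proof.
move=> ig gV; pose lt (a : gT) := (enum_rank a < enum_rank a^-1%g)%N.
exists (\sum_(a | lt a) g a); first exact: algint_sum.
rewrite (bigID lt) /= [X in _ + X = _](bigD1 1%g) /=; last first.
  by rewrite /lt invg1 ltnn.
have -> : \sum_(a | ~~ lt a && (a != 1%g)) g a = \sum_(a | lt a) g a.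
  rewrite [RHS](reindex_inj invg_inj); apply: eq_big => a; last by rewrite gV.
  rewrite /lt invgK -leqNgt leq_eqVlt andb_orl.
  case: eqVneq => [/val_inj /enum_rank_inj aa|_] /=.
    by rewrite aa (invg_fix aa) eqxx ltnn.
  by case: ltnP => //= lt_a; apply: contraTneq lt_a => ->; rewrite invg1 ltnn.
by rewrite mulr2n mulrDl !mul1r addrCA.
Qed.

(** The number of elements whose [k]-th power is trivial. *)
Definition torsion k := #|[set a : gT | (a ^+ k == 1)%g]|.

Lemma torsion1 : torsion 1 = 1%N.
Proof.
by apply: (etrans _ (cards1 (1%g : gT))); apply: eq_card => a; rewrite !inE.
Qed.

Lemma torsion_gt0 k : (0 < torsion k)%N.
Proof. by apply/card_gt0P; exists 1%g; rewrite inE expg1n. Qed.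

Lemma torsion_neq0 k : (torsion k)%:R != 0 :> K.
Proof. by rewrite pnatr_eq0 -lt0n torsion_gt0. Qed.

Lemma expgM_abelian (a b : gT) k : ((a * b) ^+ k = a ^+ k * b ^+ k)%g.
Proof. by apply/expgMn/(centsP abelian_gT); rewrite inE. Qed.

(** The sum is grouped along the fibres of a |-> a^k, which are empty or cosets
    of the [k]-torsion, and the fibres over c and c^-1 are paired. *)
Lemma sum_torsion_invariant (f : gT -> K) k :
  (forall a, algebraic_integer (f a)) -> (forall a, f a^-1%g = f a) ->
  f 1%g = 1 -> (forall a b, (b ^+ k = 1)%g -> f (a * b)%g = f a) ->
  exists2 z, algebraic_integer z &
    \sum_a f a = (torsion k)%:R * (1 + 2%:R * z).
Proof.
move=> fi fV f1 fk.
pose g c := \sum_(a | (a ^+ k == c)%g) f a.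
have gE a : g (a ^+ k)%g = (torsion k)%:R * f a.
  rewrite /g (reindex_inj (mulgI a)) /=.
  have ak b : (((a * b) ^+ k == a ^+ k) = (b ^+ k == 1))%g.
    by rewrite expgM_abelian -{2}[(a ^+ k)%g]mulg1 (inj_eq (mulgI _)).
  rewrite (eq_big (mem [set b : gT | (b ^+ k == 1)%g]) (fun=> f a)).
  - by rewrite sumr_const mulr_natl.
  - by move=> b; rewrite ak /= inE.
  by move=> b; rewrite ak => /eqP; exact: fk.
have [|c|z iz gz] := @sum_paired (fun c => g c / (torsion k)%:R).
- move=> c; have [/existsP[a /eqP <-]|] := boolP [exists a, (a ^+ k == c)%g].
    by rewrite gE mulrC mulKf ?torsion_neq0.
  rewrite negb_exists => /forallP nc.
  rewrite /g big_pred0 ?mul0r; first exact: algint0.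
  by move=> a; apply/negbTE/nc.
- congr (_ / _); rewrite /g (reindex_inj invg_inj).
  by apply: eq_big => a; [rewrite expVgn (inj_eq invg_inj)|rewrite fV].
exists z => //.
rewrite (partition_big (fun a => a ^+ k)%g xpredT) //=.
have -> : 1 + 2%:R * z = \sum_c g c / (torsion k)%:R.
  by rewrite gz -{1}(expg1n _ k) gE f1 mulr1 mulfV // torsion_neq0.
by rewrite -mulr_suml mulrC divfK // torsion_neq0.
Qed.

(** An instance of Frobenius' theorem on the solutions of x^k = 1. *)
Lemma torsion_dvd k : (k %| #|gT|)%N -> (k %| torsion k)%N.
Proof.
move=> kN; have := @Frobenius_Ldiv _ [set: gT]%G k; rewrite cardsT => /(_ kN).
rewrite (_ : #|_| = torsion k) //; apply: eq_card => a.
by rewrite !inE.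
Qed.

Lemma torsion_double k : torsion (k * 2) = torsion k.
Proof.
apply: eq_card => a; rewrite !inE expgM.
apply/eqP/eqP => [a2|->]; last exact: expg1n.
apply: invg_fix; apply/eqP; rewrite eq_invg_mul.
by rewrite -a2 expgS expg1.
Qed.

End OddGroup.

(** * Normalized Gauss sums *)

Section NormalizedGaussSum.
Variables (K : numFieldType) (gT : finGroupType) (beta : gT -> gT -> K).
Hypothesis abelian_gT : abelian [set: gT].
Hypothesis beta_bichar : bicharacter beta.
Hypothesis beta_sym : bichar_symmetric beta.
Hypothesis beta_nondeg : bichar_nondegenerate beta.
Variable q : gT -> K.
Hypothesis qM : forall a b, q (a * b)%g = q a * q b * beta a b.
Hypothesis qV : forall a, q a^-1%g = q a.
Hypothesis q_unity : forall a, q a ^+ #|gT| = 1.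
Variable tau : K.
Hypothesis tau2 : tau ^+ 2 = #|gT|%:R^-1.

Local Notation G := (gauss_sum q).
Local Notation w := (tau * G).

Lemma algint_quad a : algebraic_integer (q a).
Proof. by apply: (algint_unity (finGroup_card_gt0 gT)); exact: q_unity. Qed.

Lemma algint_quadV a : algebraic_integer (q a)^-1.
Proof.
by apply: (algint_unity (finGroup_card_gt0 gT)); rewrite exprVn q_unity invr1.
Qed.

(** With N = 4m + 1 and G = 1 + 2z, the element v = (1 + w)/2 satisfies
    v^2 - v = (w^2 - 1)/4 = z^2 + z - m w^2. *)
Lemma normalized_gauss_sum_half :
  #|gT| = 1 %[mod 4] -> algebraic_integer ((1 + w) / 2%:R).
Proof.
move=> N1; have oddN : odd #|gT|.
  by rewrite (divn_eq #|gT| 4) N1 oddD oddM andbF.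
have [m m0 Gm] :=
  gauss_sum_sq_unity beta_bichar beta_sym beta_nondeg qM q_unity.
have iw2 : algebraic_integer (w ^+ 2).
  by apply: (algint_unity m0); rewrite [w ^+ 2]exprMn tau2 [_ * (G ^+ 2)]mulrC.
have [z iz Gz] := sum_paired oddN algint_quad qV.
have N0 := finGroup_card_neq0 K gT.
have GE : G ^+ 2 = #|gT|%:R * w ^+ 2.
  by rewrite [w ^+ 2]exprMn tau2 mulrA mulfV // mul1r.
rewrite -/(gauss_sum q) (quad1 beta_bichar qM q_unity) in Gz.
have NE : #|gT|%:R = 4%:R * (#|gT| %/ 4)%:R + 1 :> K.
  by rewrite {1}(divn_eq #|gT| 4) N1 natrD natrM mulrC.
apply: algint_quadratic.
have -> : ((1 + w) / 2%:R) ^+ 2 - (1 + w) / 2%:R =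
    z ^+ 2 + z - (#|gT| %/ 4)%:R * w ^+ 2.
  apply: (mulfI (x := 4%:R)); first by rewrite pnatr_eq0.
  transitivity (w ^+ 2 - 1); first by field.
  have : G ^+ 2 = (1 + 2%:R * z) ^+ 2 by rewrite Gz.
  rewrite GE NE => E.
  transitivity ((1 + 2%:R * z) ^+ 2 - (4%:R * (#|gT| %/ 4)%:R + 1) * w ^+ 2
      + w ^+ 2 - 1); last by ring.
  by rewrite E subrr add0r.
apply: algintB; last by apply: algintM => //; exact: algint_nat.
by apply: algintD => //; apply: algintX.
Qed.

Lemma normalized_gauss_sum_X_half k : odd k ->
  #|gT| = 1 %[mod 4] -> algebraic_integer ((1 + w ^+ k) / 2%:R).
Proof.
move=> ok N1; have iv := normalized_gauss_sum_half N1.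
set v := (1 + w) / 2%:R in iv.
have wv : w = 2%:R * v - 1 by rewrite /v; field.
have iw : algebraic_integer w.
  rewrite wv; apply: algintB; last exact: algint1.
  by apply: algintM => //; exact: algint_nat.
(* w is -1 modulo 2, hence so is w^k for k odd. *)
have : algebraic_integer ((w ^+ k - (-1) ^+ k) / 2%:R).
  elim: {ok} k => [|k IH]; first by rewrite subrr mul0r; exact: algint0.
  have -> : (w ^+ k.+1 - (-1) ^+ k.+1) / 2%:R =
     w * ((w ^+ k - (-1) ^+ k) / 2%:R) + (0 - (-1) ^+ k.+1) * v.
    by rewrite !exprS /v; field.
  apply: algintD; first exact: algintM.
  apply: algintM => //; apply: algintB; [exact: algint0|apply: algintX].
  rewrite -sub0r; apply: algintB; [exact: algint0|exact: algint1].
by rewrite -signr_odd ok expr1 opprK addrC.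
Qed.

(** On the [k]-torsion, q^k has square 1 and odd order, so it is trivial and
    q^-k is invariant under translation. *)
Lemma sum_quadVX k : odd #|gT| -> exists2 z, algebraic_integer z &
  \sum_a (q a)^-1 ^+ k = (torsion gT k)%:R * (1 + 2%:R * z).
Proof.
move=> oN; apply: sum_torsion_invariant => // [a|a||a b bk].
- by apply: algintX; exact: algint_quadV.
- by rewrite qV.
- by rewrite (quad1 beta_bichar qM q_unity) invr1 expr1n.
have bbk : beta a b ^+ k = 1.
  by rewrite beta_sym -(bicharXl beta_bichar) bk (bichar1l beta_bichar).
suff qbk : q b ^+ k = 1 by rewrite qM !exprVn !exprMn bbk qbk !mulr1.
have q2 : q b ^+ 2 = beta b b.
  by rewrite (bichar_diag beta_bichar qM qV q_unity).
have qk2 : (q b ^+ k) ^+ 2 = 1.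
  by rewrite exprAC q2 -(bicharXl beta_bichar) bk (bichar1l beta_bichar).
have := q_unity b; move/(congr1 (fun x => x ^+ k)); rewrite expr1n exprAC.
by rewrite -[#|gT|]odd_double_half oN exprD expr1 -mul2n exprM qk2 expr1n mulr1.
Qed.

(** Closed form of the transfer recursion: each step is a Gauss sum
    sum_x beta(b y^-1, x) q(x), evaluated by completing the square. *)
Lemma transfer_iter (t : nat -> gT -> K) :
  (forall y, t 0%N y = 1) ->
  (forall k y, t k.+1 y =
     tau * \sum_x (beta x y)^-1 * beta x x * t k x) ->
  forall k y, #|gT|%:R * t k y =
    tau ^+ k * (q y)^-1 * G ^+ k.+1 * \sum_b (q b)^-1 ^+ k.+1 * beta b y.
Proof.
move=> t0 tS; have q0 := quad_neq0 q_unity.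
have sq c : \sum_x beta c x * q x = G * (q c)^-1 by exact: complete_square.
elim=> [|k IH] y.
  rewrite t0 mulr1 expr0 mul1r expr1.
  rewrite -(gauss_sum_norm beta_bichar beta_nondeg qM q_unity).
  rewrite -mulrA mulrCA; congr (_ * _).
  rewrite [X in _ * X](reindex_inj (mulIg y)) mulr_sumr /=.
  apply: eq_bigr => b _; rewrite expr1 (bicharMl beta_bichar) qM.
  rewrite (bichar_diag beta_bichar qM qV q_unity).
  by field; rewrite !q0 bichar_neq0.
pose p b := (q b)^-1 ^+ k.+1.
rewrite tS mulrCA mulr_sumr.
have -> : \sum_x #|gT|%:R * ((beta x y)^-1 * beta x x * t k x) =
    \sum_x \sum_b tau ^+ k * G ^+ k.+1 * p b * (beta (b * y^-1)%g x * q x).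
  apply: eq_bigr => x _; rewrite mulrCA IH mulrA mulr_sumr.
  apply: eq_bigr => b _; rewrite -/(p b) (bicharMl beta_bichar).
  rewrite (bicharVl beta_bichar) (beta_sym y x).
  rewrite (bichar_diag beta_bichar qM qV q_unity).
  by field; rewrite q0 bichar_neq0.
rewrite exchange_big !mulr_sumr; apply: eq_bigr => b _ /=.
rewrite -mulr_sumr sq qM qV (bicharVr beta_bichar) !exprS -/(p b).
have -> : (q b)^-1 ^+ k = p b * q b by rewrite /p exprS mulrAC mulVf ?mul1r.
by field; rewrite !q0 bichar_neq0.
Qed.

End NormalizedGaussSum.

(** * Matrix calculus in the Tambara-Yamagami category *)

(** A morphism is handled through its entries [ty_entry f i j], and a summand p
    of a tensor product through its two legs [lft p], [rgt p] and its label. *)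

Section Entries.
Local Open Scope complex_scope.
Variables (R : realType) (gT : finGroupType).
Implicit Types (X Y Z : ty_obj gT).
Local Notation lab := ty_lab.

Lemma ty_chan_eqE X Y (p q : ty_idx (ty_tens X Y)) :
  (p == q) = [&& lft p == lft q, rgt p == rgt q & lab p == lab q].
Proof.
by rewrite -val_eqE andbA; case: p q => [[[i j] u] h] [[[i' j'] u'] h'].
Qed.

(** The summand [u] of the tensor product of the summands [i] and [j]. *)
Definition chan X Y (i : ty_idx X) (j : ty_idx Y) u
  (h : ty_fuses (lab i) (lab j) u) : ty_idx (ty_tens X Y) :=
  exist _ (i, j, u) h.

Lemma chanP X Y (p : ty_idx (ty_tens X Y)) :
  ty_fuses (lab (lft p)) (lab (rgt p)) (lab p).
Proof. exact: (valP p). Qed.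

Lemma chanE X Y (i : ty_idx X) (j : ty_idx Y) u
    (h : ty_fuses (lab i) (lab j) u) :
  (lft (chan h) = i) * (rgt (chan h) = j) * (lab (chan h) = u).
Proof. by []. Qed.

Lemma chan_ex X Y (i : ty_idx X) (j : ty_idx Y) u :
  ty_fuses (lab i) (lab j) u ->
  exists p : ty_idx (ty_tens X Y), [/\ lft p = i, rgt p = j & lab p = u].
Proof. by move=> h; exists (chan h). Qed.

Lemma eq_chan X Y (p : ty_idx (ty_tens X Y)) i j u
    (h : ty_fuses (lab i) (lab j) u) :
  (p == chan h) = [&& lft p == i, rgt p == j & lab p == u].
Proof. by rewrite ty_chan_eqE !chanE. Qed.

Lemma ty_entry0 X Y (f : ty_hom R X Y) i j :
  lab i != lab j -> ty_entry f i j = 0.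
Proof. by move=> h; rewrite /ty_entry insubF //=; apply: negbTE. Qed.

(** The label test hidden in a composite is redundant: the entries already
    vanish between summands with different labels. *)
Lemma ty_entry_comp X Y Z (g : ty_hom R Y Z) (f : ty_hom R X Y) i k :
  ty_entry (ty_comp g f) i k = \sum_j ty_entry f i j * ty_entry g j k.
Proof.
rewrite ty_entry_mor; case: eqP => // /eqP ik.
rewrite big1 // => j _; case: (eqVneq (lab i) (lab j)) => [ij|ij].
  by rewrite (@ty_entry0 Y Z) ?mulr0 // -ij.
by rewrite (@ty_entry0 X Y) ?mul0r.
Qed.

Lemma ty_entry_id X i j : ty_entry (ty_id R X) i j = (i == j)%:R.
Proof.
rewrite ty_entry_mor; case: (eqVneq i j) => [->|_]; first by rewrite eqxx.
by case: ifP.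
Qed.

Lemma ty_entry_tensm X X' Y Y' (f : ty_hom R X X') (g : ty_hom R Y Y') p q :
  ty_entry (ty_tensm f g) p q =
    (lab p == lab q)%:R *
      (ty_entry f (lft p) (lft q) * ty_entry g (rgt p) (rgt q)).
Proof. by rewrite ty_entry_mor; case: eqP; rewrite ?mul1r ?mul0r. Qed.

Lemma ty_homP X Y (f g : ty_hom R X Y) : ty_entry f =2 ty_entry g -> f = g.
Proof.
move=> fg; apply/ffunP => p; have := fg (val p).1 (val p).2.
by rewrite /ty_entry -surjective_pairing valK.
Qed.

Lemma ty_entryD X Y (f g : ty_hom R X Y) i j :
  ty_entry (f + g) i j = ty_entry f i j + ty_entry g i j.
Proof. by rewrite /ty_entry; case: insub => [p|]; rewrite ?ffunE ?addr0. Qed.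

Lemma ty_entryZ X Y a (f : ty_hom R X Y) i j :
  ty_entry (a *: f) i j = a * ty_entry f i j.
Proof. by rewrite /ty_entry; case: insub => [p|]; rewrite ?ffunE ?mulr0. Qed.

Lemma ty_entry_sum X Y (I : finType) (P : pred I) (f : I -> ty_hom R X Y) i j :
  ty_entry (\sum_(k | P k) f k) i j = \sum_(k | P k) ty_entry (f k) i j.
Proof.
apply: (big_morph (fun f : ty_hom R X Y => ty_entry f i j)) => [g h|].
  exact: ty_entryD.
by rewrite /ty_entry; case: insub => [p|]; rewrite ?ffunE.
Qed.

(** The trace of an operator on Hom(1, X) given by a matrix indexed by the
    summands of X: only the summands of label 1 contribute. *)
Lemma end_trace_kernel X
    (E : ty_hom R (ty_unit gT) X -> ty_hom R (ty_unit gT) X)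
    (M : ty_idx X -> ty_idx X -> R[i]) :
  (forall f w, ty_entry (E f) tt w =
     (lab w == Some 1%g)%:R * \sum_v ty_entry f tt v * M v w) ->
  end_trace E = \sum_(w | lab w == Some 1%g) M w w.
Proof.
move=> EM.
pose e w : ty_hom R (ty_unit gT) X := ty_mor (fun _ j => (j == w)%:R).
have eE w v : ty_entry (e w) tt v = (lab v == Some 1%g)%:R * (v == w)%:R.
  by rewrite ty_entry_mor eq_sym; case: eqP; rewrite ?mul1r ?mul0r.
have dec (f : ty_hom R (ty_unit gT) X) :
    f = \sum_(w | lab w == Some 1%g) ty_entry f tt w *: e w.
  apply: ty_homP => -[] v; rewrite ty_entry_sum.
  have [h|h] := eqVneq (lab v) (Some 1%g); last first.
    rewrite ty_entry0 1?eq_sym // big1 // => w _.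
    by rewrite ty_entryZ eE (negbTE h) mul0r mulr0.
  rewrite (big_only1 v) ?h // => [|w nw _]; rewrite ty_entryZ eE h eqxx.
    by rewrite eqxx !mulr1.
  by rewrite eq_sym (negbTE nw) !mulr0.
rewrite /end_trace.
pose V := ty_hom R (ty_unit gT) X.
under eq_bigr => i _.
  rewrite (dec (E _)) linear_sum /=.
  under eq_bigr => w hw do rewrite linearZ /= EM hw mul1r mulr_suml.
  over.
rewrite exchange_big; apply: eq_bigr => w hw.
rewrite exchange_big (big_only1 w) //=.
  transitivity (M w w * ty_entry (\sum_(i < \dim {:V})
     coord (vbasis {:V}) i (e w) *: (vbasis {:V})`_i) tt w).
    rewrite ty_entry_sum mulr_sumr; apply: eq_bigr => i _.
    by rewrite ty_entryZ mulrAC mulrC (mulrC (ty_entry _ _ _)).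
  by rewrite -coord_vbasis ?memvf // eE hw eqxx !mulr1.
move=> v nv _.
  transitivity (M v w * ty_entry (\sum_(i < \dim {:V})
     coord (vbasis {:V}) i (e w) *: (vbasis {:V})`_i) tt v).
    rewrite ty_entry_sum mulr_sumr; apply: eq_bigr => i _.
    by rewrite ty_entryZ mulrAC mulrC (mulrC (ty_entry _ _ _)).
  by rewrite -coord_vbasis ?memvf // eE (negbTE nv) !mulr0.
Qed.

Lemma sum_chan X Y (G : ty_idx X -> ty_idx Y -> ty_label gT -> R[i]) :
  \sum_(p : ty_idx (ty_tens X Y)) G (lft p) (rgt p) (lab p) =
  \sum_i \sum_j \sum_(u | ty_fuses (lab i) (lab j) u) G i j u.
Proof.
rewrite pair_bigA /= (pair_big_dep xpredT _ (fun q u => G q.1 q.2 u)) /=.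
rewrite (big_sub (fun p : ty_idx X * ty_idx Y * ty_label gT =>
    ty_fuses (lab p.1.1) (lab p.1.2) p.2) (fun p => G p.1.1 p.1.2 p.2)).
by [].
Qed.

Lemma sum_simplel s Y (G : ty_idx Y -> ty_label gT -> R[i]) :
  \sum_(p : ty_idx (ty_tens (ty_simple s) Y)) G (rgt p) (lab p) =
  \sum_j \sum_(u | ty_fuses s (lab j) u) G j u.
Proof.
rewrite (sum_chan (fun _ : ty_idx (ty_simple s) => G)).
by rewrite (big_only1 tt) //; case.
Qed.

Lemma sum_simpler s X (G : ty_idx X -> ty_label gT -> R[i]) :
  \sum_(p : ty_idx (ty_tens X (ty_simple s))) G (lft p) (lab p) =
  \sum_i \sum_(u | ty_fuses (lab i) s u) G i u.
Proof.
rewrite (sum_chan (fun i (_ : ty_idx (ty_simple s)) => G i)).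
by apply: eq_bigr => i _; rewrite (big_only1 tt) //; case.
Qed.

End Entries.

(** * The duality isomorphisms *)

Section Duality.
Local Open Scope complex_scope.
Variables (R : realType) (gT : finGroupType).
Variables (chi : gT -> gT -> R[i]) (tau : R).
Hypothesis chi_bichar : bicharacter chi.
Hypothesis tau0 : tau != 0.
Implicit Types (X Y Z : ty_obj gT) (s : ty_label gT).
Local Notation lab := ty_lab.
Local Notation C := (ty_pivotal chi tau).

Lemma ty_fuses_dual s t : ty_fuses s t (Some 1%g) = (t == dual_label s).
Proof.
case: s t => [a|] [b|] //=.
rewrite eq_sym -(inj_eq (mulgI a^-1%g)) mulKg mulg1.
by apply/eqP/eqP => [->|[->]].
Qed.

Lemma ty_fuses_1l s u : ty_fuses (Some 1%g) s u = (u == s).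
Proof. by case: s u => [a|] [b|] //=; rewrite mul1g. Qed.

Lemma ty_fuses_1r s u : ty_fuses s (Some 1%g) u = (u == s).
Proof. by case: s u => [a|] [b|] //=; rewrite mulg1. Qed.

Lemma dual_labelK : involutive (@dual_label gT).
Proof. by case=> //= a; rewrite invgK. Qed.

(** The scalar of the evaluation of the simple object of label [s]. *)
Definition ev_scalar s : R[i] := if s is None then (tau%:C)^-1 else 1.

(** The last two maps of [dualA], as a matrix. *)
Lemma dualA_inner s X
    (t : ty_idx (ty_tens (ty_tens (ty_dual (ty_simple s)) (ty_simple s)) X)) i :
  ty_entry (ty_comp (ty_lunit R X)
      (ty_tensm (ty_ev tau (ty_simple s)) (ty_id R X))) t i =
  [&& rgt t == i, lab t == lab i & lab (lft t) == Some 1%g]%:R * ev_scalar s.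
Proof.
rewrite ty_entry_comp.
have [e|ne] := eqVneq (lab t) (lab (rgt t)); last first.
  rewrite big1 => [|v _].
    case: (eqVneq (rgt t) i) => [h|] /=; last by rewrite mul0r.
    by rewrite -h (negbTE ne) mul0r.
  rewrite ty_entry_tensm ty_entry_id ty_entry_mor.
  have := chanP v; rewrite ty_fuses_1l => /eqP hv.
  case: (eqVneq (lab t) (lab v)) => [h|]; last by rewrite !mul0r.
  case: (eqVneq (rgt t) (rgt v)) => [h'|]; last by rewrite mulr0 mulr0 mul0r.
  by move: ne; rewrite h h' hv eqxx.
have H : ty_fuses (lab (tt : ty_idx (ty_unit gT))) (lab (rgt t)) (lab t).
  by rewrite ty_fuses_1l e.
rewrite (big_only1 (chan H)) //.
  rewrite ty_entry_tensm ty_entry_id !ty_entry_mor !chanE !eqxx mul1r mulr1.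
  rewrite !(eq_sym (lab t) (lab i)) e.
  have -> : (lft (lft t) == rgt (lft t) :> unit) by [].
  case: (eqVneq (rgt t) i) => [<-|ne]; last by rewrite if_same mulr0 mul0r.
  by rewrite eqxx mulr1 !mul1r /=; case: ifP; rewrite ?mul1r ?mul0r.
move=> v nv _; rewrite ty_entry_tensm ty_entry_id.
case: (eqVneq (lab t) (lab v)) => [h|]; last by rewrite !mul0r.
case: (eqVneq (rgt t) (rgt v)) => [h'|]; last by rewrite mulr0 mulr0 mul0r.
by case/negP: nv; rewrite eq_chan h h' !eqxx andbT; case: (lft v).
Qed.

(** The inverse associativity followed by these maps.  For m the coefficient
    tau of the former cancels the coefficient tau^-1 of the evaluation. *)
Lemma dualA_outer s X
    (q : ty_idx (ty_tens (ty_dual (ty_simple s)) (ty_tens (ty_simple s) X))) i :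
  lab (rgt q) = Some 1%g ->
  \sum_t
    ty_entry (ty_assocV chi tau (ty_dual (ty_simple s)) (ty_simple s) X) q t
    * ([&& rgt t == i, lab t == lab i & lab (lft t) == Some 1%g]%:R
        * ev_scalar s)
  = (rgt (rgt q) == i)%:R.
Proof.
move=> q1.
have /esym := chanP (rgt q); rewrite q1 ty_fuses_dual => /esym/eqP e1.
have := chanP q; rewrite q1 ty_fuses_1r => /eqP e2.
have [qi|ne] := eqVneq (rgt (rgt q)) i; last first.
  apply: big1 => t _; rewrite ty_entry_mor.
  case: (eqVneq (rgt t) i) => [h|] /=; last by rewrite mul0r mulr0.
  rewrite /same_legs h eq_sym in ne *.
  by rewrite (negbTE ne) !andbF mul0r if_same mul0r.
have H1 : ty_fuses (lab (lft q)) (lab (lft (rgt q))) (Some 1%g).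
  by rewrite ty_fuses_dual /= dual_labelK.
have H2 : ty_fuses (lab (chan H1)) (lab i) (lab q).
  by rewrite chanE ty_fuses_1l e2 -qi e1.
rewrite (big_only1 (chan H2)) //.
  have e3 : lab i = dual_label s by rewrite -qi e1.
  have e4 : lab q = dual_label s by rewrite e2.
  rewrite ty_entry_mor !chanE /same_legs !chanE qi q1 e3 e4 !eqxx !mul1r.
  rewrite (_ : lab (lft (rgt q)) = s) // (_ : lab (lft q) = dual_label s) //.
  move: s {q i q1 e1 e2 e3 e4 qi H1 H2} => [a|] /=; first by rewrite mul1r.
  by rewrite (bichar1r chi_bichar) mulr1 mulfV // fmorph_eq0.
move=> t nt _; rewrite ty_entry_mor /same_legs.
case: eqP => [h|]; last by rewrite mul0r.
case: and3P => [[/eqP a1 /eqP a2 /eqP a3]|]; last by rewrite !mul0r.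
case: and3P => [[/eqP b1 /eqP b2 /eqP b3]|]; last by rewrite !(mul0r, mulr0).
case/negP: nt; rewrite eq_chan eq_chan b1 b3 -h !eqxx !andbT.
by case: (lft (lft t)) (lft q) (rgt (lft t)) (lft (rgt q)) => [] [] [] [].
Qed.

(** [dualA f] has the same coefficients as [f]: at most one summand of
    s X over i has label 1, and no scalar appears. *)
Lemma dualA_entry s X (f : ty_hom R (ty_unit gT) (ty_tens (ty_simple s) X))
    (p : ty_idx (ty_tens (ty_dual (ty_simple s)) (ty_unit gT))) i :
  ty_entry (X := ty_tens (ty_dual (ty_simple s)) (ty_unit gT)) (Y := X)
    (dualA (C := C) (Y := ty_simple s) f) p i =
  \sum_(r | rgt r == i) ty_entry f tt r.
Proof.
have p1 : lab p = dual_label s.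
  have := chanP p; rewrite (_ : lab (rgt p) = Some 1%g) // ty_fuses_1r.
  by move=> /eqP ->.
transitivity (ty_entry (ty_comp (ty_comp (ty_comp (ty_lunit R X)
    (ty_tensm (ty_ev tau (ty_simple s)) (ty_id R X)))
    (ty_assocV chi tau (ty_dual (ty_simple s)) (ty_simple s) X))
    (ty_tensm (ty_id R (ty_dual (ty_simple s))) f)) p i); first by [].
rewrite ty_entry_comp.
under eq_bigr => q _.
  rewrite ty_entry_comp ty_entry_tensm ty_entry_id.
  under eq_bigr => t _ do rewrite dualA_inner.
  have -> : (lft p == lft q) by case: (lft p) (lft q) => [] [].
  rewrite mul1r.
  have -> : (lab p == lab q)%:R * ty_entry f (rgt p) (rgt q) *
    (\sum_t ty_entry (ty_assocV chi tau (ty_dual (ty_simple s)) (ty_simple s) X)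
        q t * ([&& rgt t == i, lab t == lab i & lab (lft t) == Some 1%g]%:R *
               ev_scalar s)) =
    (dual_label s == lab q)%:R * ty_entry f tt (rgt q) *
      (rgt (rgt q) == i)%:R :> R[i].
    rewrite p1; case: (rgt p).
    have [h|h] := eqVneq (lab (rgt q)) (Some 1%g); first by rewrite dualA_outer.
    by rewrite ty_entry0 ?mulr0 ?mul0r // eq_sym.
  over.
rewrite (sum_simplel (dual_label s) (fun r u =>
   (dual_label s == u)%:R * ty_entry f tt r * (rgt r == i)%:R)).
rewrite [RHS]big_mkcond; apply: eq_bigr => r _.
have [h|h] := eqVneq (lab r) (Some 1%g); last first.
  rewrite ty_entry0 1?eq_sym // if_same big1 // => u _.
  by rewrite mulr0 mul0r.
rewrite h (big_only1 (dual_label s)) ?ty_fuses_1r //.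
  by rewrite eqxx mul1r; case: eqP; rewrite ?mulr1 ?mulr0.
by move=> u; rewrite eq_sym => /negbTE->; rewrite !mul0r.
Qed.

(** Likewise for [dualB]; the sum over r has a single term, the index set of
    1 s being a singleton. *)
Lemma dualB_entry s X (g : ty_hom R (ty_tens (ty_unit gT) (ty_simple s)) X)
    (p : ty_idx (ty_tens X (ty_dual (ty_simple s)))) :
  ty_entry (X := ty_unit gT) (Y := ty_tens X (ty_dual (ty_simple s)))
    (dualB (C := C) (Y := ty_simple s) g) tt p =
  (lab p == Some 1%g)%:R * \sum_r ty_entry g r (lft p).
Proof.
have assocVg b : \sum_c ty_entry (ty_assocV chi tau (ty_unit gT) (ty_simple s)
      (ty_dual (ty_simple s))) b c
    * ty_entry (ty_tensm g (ty_id R (ty_dual (ty_simple s)))) c p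
    = (lab b == lab p)%:R * \sum_r ty_entry g r (lft p).
  under eq_bigr => c _.
    rewrite ty_entry_tensm ty_entry_id ty_entry_mor.
    have -> : (rgt c == rgt p) by case: (rgt c) (rgt p) => [] [].
    have -> : same_legs c b.
      rewrite /same_legs; case: (lft (lft c)) (lft b) (rgt (lft c))
        (lft (rgt b)) => [] [] [] [].
      by case: (rgt c) (rgt (rgt b)) => [] [].
    rewrite (_ : ty_FV _ _ _ _ _ _ _ _ = 1); last by rewrite /=; case: (s).
    rewrite !mulr1.
    over.
  rewrite (sum_simpler (dual_label s) (fun r u =>
     (if lab b == u then 1 else 0) *
     ((u == lab p)%:R * ty_entry g r (lft p)))).
  rewrite mulr_sumr; apply: eq_bigr => r _.
  have [h|h] := eqVneq (lab r) (lab (lft p)); last first.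
    by rewrite ty_entry0 // mulr0 big1 // => u _; rewrite !mulr0.
  rewrite (big_only1 (lab p)) ?h; last first.
  - by move=> u /negbTE-> _; rewrite mul0r mulr0.
  - exact: (chanP p).
  by rewrite eqxx mul1r; case: eqP.
transitivity (ty_entry (ty_comp (ty_comp (ty_comp
    (ty_tensm g (ty_id R (ty_dual (ty_simple s))))
    (ty_assocV chi tau (ty_unit gT) (ty_simple s) (ty_dual (ty_simple s))))
    (ty_tensm (ty_id R (ty_unit gT)) (ty_coev R (ty_simple s))))
    (ty_runitV R (ty_unit gT))) tt p); first by [].
rewrite ty_entry_comp.
have H : ty_fuses (lab (tt : ty_idx (ty_unit gT)))
   (lab (tt : ty_idx (ty_unit gT))) (Some 1%g) by rewrite ty_fuses_1l.
rewrite (big_only1 (chan H)) //; last first.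
  move=> a; have := chanP a; rewrite ty_fuses_1l => /eqP h.
  rewrite eq_chan h; case: (lft a) => /=; case: (rgt a) => /=.
  by rewrite eqxx.
rewrite ty_entry_mor !chanE !eqxx mul1r ty_entry_comp.
under eq_bigr => b _.
  rewrite ty_entry_comp assocVg ty_entry_tensm ty_entry_id ty_entry_mor !chanE.
  have -> : (tt == lft b) by case: (lft b).
  have -> : (lft (rgt b) == rgt (rgt b) :> unit).
    by case: (lft (rgt b)) (rgt (rgt b)) => [] [].
  rewrite mul1r.
  over.
have H1 : ty_fuses (lab (tt : ty_idx (ty_simple s)))
   (lab (tt : ty_idx (ty_dual (ty_simple s)))) (Some 1%g).
  by rewrite ty_fuses_dual.
have H2 : ty_fuses (lab (tt : ty_idx (ty_unit gT))) (lab (chan H1)) (Some 1%g).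
  by rewrite ty_fuses_1l.
rewrite (big_only1 (chan H2)) //.
  by rewrite !chanE !eqxx !mul1r eq_sym.
move=> b nb _.
case: eqP => [h|]; last by rewrite !mul0r.
case: eqP => [h'|]; last by rewrite mulr0 mul0r.
case/negP: nb; rewrite !eq_chan -h -h' !eqxx !andbT.
by case: (lft b) (lft (rgt b)) (rgt (rgt b)) => [] [] [].
Qed.
Lemma sum_dual s X (f : ty_hom R (ty_unit gT) (ty_tens (ty_simple s) X)) i :
  \sum_r ty_entry (X := ty_tens (ty_unit gT) (ty_dual (ty_simple s))) (Y := X)
     (hcomp (p := C) (hcomp (p := C) (dualA (C := C) (Y := ty_simple s) f)
       (runitV (p := C) (ldual (ty_simple s : obj C))))
       (lunit (p := C) (ldual (ty_simple s : obj C)))) r i =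
  \sum_(r | rgt r == i) ty_entry f tt r.
Proof.
set D := RHS.
have inner x : ty_entry (ty_comp (Y := ty_tens (ty_dual (ty_simple s))
      (ty_unit gT)) (dualA (C := C) (Y := ty_simple s) f)
      (ty_runitV R (ty_dual (ty_simple s)))) x i = D.
  rewrite ty_entry_comp.
  under eq_bigr => y _ do rewrite dualA_entry -/D.
  have H : ty_fuses (lab x) (lab (tt : ty_idx (ty_unit gT))) (lab x).
    by rewrite ty_fuses_1r.
  rewrite (big_only1 (chan H)) //.
    by rewrite ty_entry_mor chanE eqxx chanE eqxx mul1r.
  move=> y; rewrite eq_chan; have := chanP y; rewrite ty_fuses_1r => /eqP ->.
  by case: (lft y) (rgt y) (x) => [] [] [] /=; rewrite eqxx.
transitivity (\sum_r ty_entry (ty_comp (ty_comp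
      (Y := ty_tens (ty_dual (ty_simple s)) (ty_unit gT))
      (dualA (C := C) (Y := ty_simple s) f)
      (ty_runitV R (ty_dual (ty_simple s))))
      (ty_lunit R (ty_dual (ty_simple s)))) r i); first by [].
have H : ty_fuses (lab (tt : ty_idx (ty_unit gT)))
    (lab (tt : ty_idx (ty_dual (ty_simple s)))) (dual_label s).
  by rewrite ty_fuses_1l.
rewrite (big_only1 (chan H)) //; last first.
  move=> r; rewrite eq_chan; have := chanP r; rewrite ty_fuses_1l => /eqP ->.
  by case: (lft r) (rgt r) => [] [] /=; rewrite eqxx.
rewrite ty_entry_comp (big_only1 tt) //.
by rewrite inner ty_entry_mor !chanE !eqxx mul1r.
Qed.

Lemma tensm_pivV_entry s X
    (h : ty_hom R (ty_unit gT) (ty_tens X (ty_dual (ty_dual (ty_simple s)))))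
    (p : ty_idx (ty_tens X (ty_simple s))) G :
  (forall p', ty_entry h tt p' = (lab p' == Some 1%g)%:R * G (lft p')) ->
  ty_entry (ty_comp (ty_tensm (ty_id R X) (ty_pivV tau (ty_simple s))) h) tt p
  = (lab p == Some 1%g)%:R * (G (lft p) * (piv_scalar tau s)^-1).
Proof.
move=> hG; rewrite ty_entry_comp.
have H : ty_fuses (lab (lft p))
    (lab (rgt p : ty_idx (ty_dual (ty_dual (ty_simple s))))) (lab p).
  by rewrite /= dual_labelK; exact: (chanP p).
rewrite (big_only1 (chan H)) //.
  rewrite hG !chanE -mulrA ty_entry_tensm !chanE ty_entry_id !eqxx !mul1r.
  rewrite ty_entry_mor ifT; last by rewrite /= dual_labelK.
  by rewrite eqxx mul1r.
move=> p' np _; rewrite ty_entry_tensm ty_entry_id.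
case: (eqVneq (lab p') (lab p)) => [a|_]; last by rewrite !mul0r mulr0.
case: (eqVneq (lft p') (lft p)) => [b|_]; last by rewrite mul0r !mulr0.
case/negP: np; rewrite eq_chan a b !eqxx andbT.
by case: (rgt p') (rgt p) => [] [].
Qed.

(** One step of the iterated associativity (s X) s -> s (X s) -> s Z. *)
Lemma assoc_step s X Z (Phi : ty_hom R (ty_tens X (ty_simple s)) Z)
    (p : ty_idx (ty_tens (ty_tens (ty_simple s) X) (ty_simple s)))
    (w : ty_idx (ty_tens (ty_simple s) Z)) :
  lab p = lab w ->
  ty_entry (ty_comp (ty_tensm (ty_id R (ty_simple s)) Phi)
     (ty_assoc chi tau (ty_simple s) X (ty_simple s))) p w =
  \sum_(r | lft r == rgt (lft p))
     ty_F chi tau s (lab (lft r)) s (lab (lft p)) (lab r) (lab p)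
       * ty_entry Phi r (rgt w).
Proof.
move=> pw; rewrite ty_entry_comp.
pose F (r : ty_idx (ty_tens X (ty_simple s))) u := if u == lab w then
  (lft r == rgt (lft p))%:R *
    ty_F chi tau s (lab (lft r)) s (lab (lft p)) (lab r) u *
    ty_entry Phi r (rgt w) else 0.
transitivity (\sum_(q : ty_idx (ty_tens (ty_simple s)
                           (ty_tens X (ty_simple s)))) F (rgt q) (lab q)).
  apply: eq_bigr => q _.
  rewrite ty_entry_mor ty_entry_tensm ty_entry_id /F pw (eq_sym (lab w)).
  case: (eqVneq (lab q) (lab w)) => [->|_]; last by rewrite !mul0r.
  have -> : (lft q == lft w) by case: (lft q) (lft w) => [] [].
  have -> : same_legs p q = (lft (rgt q) == rgt (lft p)).
    rewrite /same_legs (eq_sym (rgt (lft p))).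
    have -> : (lft (lft p) == lft q) by case: (lft (lft p)) (lft q) => [] [].
    have -> : (rgt p == rgt (rgt q)) by case: (rgt p) (rgt (rgt q)) => [] [].
    by rewrite andbT.
  by rewrite !mul1r.
rewrite sum_simplel [RHS]big_mkcond.
apply: eq_bigr => r _; rewrite /F.
case: eqP => [a|_]; last by apply: big1 => u _; rewrite !mul0r if_same.
have [b|b] := eqVneq (lab r) (lab (rgt w)); last first.
  by rewrite ty_entry0 // mulr0; apply: big1 => u _; rewrite mulr0 if_same.
rewrite (big_only1 (lab w)).
- by rewrite eqxx mul1r pw.
- by rewrite b; exact: (chanP w).
by move=> u /negbTE ->.
Qed.

End Duality.

(** * The trace of the rotation on tensor powers *)

Section Powers.
Local Open Scope complex_scope.
Variables (R : realType) (gT : finGroupType).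
Variables (chi : gT -> gT -> R[i]) (tau : R).
Hypothesis abelian_gT : abelian [set: gT].
Hypothesis chi_bichar : bicharacter chi.
Hypothesis tau0 : tau != 0.
Local Notation lab := ty_lab.
Local Notation C := (ty_pivotal chi tau).
Local Notation V s := (ty_simple s : obj C).
Local Notation T s n := (@tpow _ C (ty_simple s) n : ty_obj gT).

(** The summand of V^n from which a summand of V^(n+1) = V V^n is built; for
    n = 0 the unit object has a single summand. *)
Definition tpow_tail s n : ty_idx (T s n.+1) -> ty_idx (T s n) :=
  match n return ty_idx (T s n.+1) -> ty_idx (T s n) with
  | 0 => fun=> tt
  | k.+1 => fun w => rgt w
  end.

Lemma tpow_tailP s n (w : ty_idx (T s n.+1)) :
  ty_fuses s (lab (tpow_tail w)) (lab w).
Proof.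
case: n w => [|n] w; last exact: (chanP w).
by case: w; case: s => //= a; rewrite mulg1.
Qed.

Lemma ty_fusesC (s t u : ty_label gT) : ty_fuses s t u = ty_fuses t s u.
Proof.
case: s t u => [a|] [b|] [c|] //=.
by rewrite (centsP abelian_gT a _ b) ?inE.
Qed.

Lemma tpow_split_entry s n (v : ty_idx (T s n.+1))
    (r : ty_idx (ty_tens (ty_simple s) (T s n))) :
  ty_entry (X := T s n.+1) (Y := ty_tens (ty_simple s) (T s n))
    (tpow_split (V s) n) v r = ((tpow_tail v == rgt r) && (lab v == lab r))%:R.
Proof.
case: n v r => [|n] v r.
  rewrite [LHS]ty_entry_mor; case: v; case: (lft r); case: (rgt r) => /=.
  by case: eqP.
rewrite [LHS]ty_entry_id ty_chan_eqE.
by rewrite (_ : lft v == lft r) //; case: (lft v) (lft r) => [] [].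
Qed.

Lemma sum_tpow_split s n (v : ty_idx (T s n.+1)) i :
  \sum_(r : ty_idx (ty_tens (ty_simple s) (T s n)) | rgt r == i)
     ty_entry (X := T s n.+1) (Y := ty_tens (ty_simple s) (T s n))
        (tpow_split (V s) n) v r = (tpow_tail v == i)%:R.
Proof.
have H : ty_fuses (lab (tt : ty_idx (ty_simple s))) (lab (tpow_tail v)) (lab v).
  exact: tpow_tailP.
rewrite big_mkcond (big_only1 (chan H)) //.
  by rewrite tpow_split_entry !chanE !eqxx; case: eqP.
move=> r nr _; rewrite tpow_split_entry; case: ifP => // _.
rewrite (_ : _ && _ = false) //; apply/negbTE; apply: contra nr.
move=> /andP[/eqP a /eqP b]; rewrite eq_chan a b !eqxx !andbT.
by case: (lft r).
Qed.

(** The rotation reads f at the summands over [lft p] and transports it by the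
    associativity isomorphism, up to the scalar of the pivotal structure. *)
Lemma fs_rot_entry s n (f : ty_hom R (ty_unit gT) (T s n.+1)) w :
  ty_entry (X := ty_unit gT) (Y := T s n.+1) (fs_rot (V := V s) f) tt w =
  \sum_v ty_entry f tt v * ((piv_scalar tau s)^-1 *
    \sum_(p : ty_idx (ty_tens (T s n) (ty_simple s))
        | (lft p == tpow_tail v) && (lab p == Some 1%g))
      ty_entry (X := ty_tens (T s n) (ty_simple s)) (Y := T s n.+1)
        (assoc_pow (V s) n) p w).
Proof.
pose X := T s n.
pose f' : ty_hom R (ty_unit gT) (ty_tens (ty_simple s) X) :=
  hcomp (p := C) (tpow_split (V s) n) f.
pose G (i : ty_idx X) := \sum_v ty_entry f tt v * (tpow_tail v == i)%:R.
have GE i : \sum_(r | rgt r == i) ty_entry f' tt r = G i.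
  transitivity (\sum_(r | rgt r == i) \sum_v ty_entry f tt v *
    ty_entry (X := T s n.+1) (Y := ty_tens (ty_simple s) (T s n))
        (tpow_split (V s) n) v r).
    by apply: eq_bigr => r _; exact: ty_entry_comp.
  rewrite exchange_big; apply: eq_bigr => v _.
  by rewrite -mulr_sumr sum_tpow_split.
pose h : ty_hom R (ty_unit gT) (ty_tens X (ty_dual (ty_dual (ty_simple s)))) :=
  dualB (C := C) (Y := ldual (V s)) (hcomp (p := C) (hcomp (p := C)
    (dualA (C := C) (Y := V s) f') (runitV (p := C) (ldual (V s))))
    (lunit (p := C) (ldual (V s)))).
have hE p' : ty_entry h tt p' = (lab p' == Some 1%g)%:R * G (lft p').
  transitivity ((lab p' == Some 1%g)%:R *
      \sum_(r | rgt r == lft p') ty_entry f' tt r); last by rewrite GE.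
  rewrite -(sum_dual chi_bichar tau0).
  exact: (@dualB_entry R gT chi tau (dual_label s) X _ p').
transitivity (\sum_(p : ty_idx (ty_tens X (ty_simple s)))
   ty_entry (ty_comp (ty_tensm (ty_id R X) (ty_pivV tau (ty_simple s))) h) tt p
   * ty_entry (X := ty_tens X (ty_simple s)) (Y := T s n.+1)
        (assoc_pow (V s) n) p w).
  transitivity (ty_entry (ty_comp (ty_comp (Y := ty_tens X (ty_simple s))
     (Z := T s n.+1) (assoc_pow (V s) n)
     (ty_tensm (ty_id R X) (ty_pivV tau (ty_simple s)))) h) tt w); first by [].
  rewrite ty_entry_comp.
  under eq_bigr => p' _ do rewrite ty_entry_comp mulr_sumr.
  rewrite exchange_big; apply: eq_bigr => p _.
  by rewrite ty_entry_comp mulr_suml; apply: eq_bigr => p' _; rewrite mulrA.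
under eq_bigr => p _.
  rewrite (tensm_pivV_entry tau p hE) /G mulr_suml !mulr_sumr mulr_suml.
  over.
rewrite exchange_big; apply: eq_bigr => v _.
rewrite !mulr_sumr [RHS]big_mkcond; apply: eq_bigr => p _.
rewrite (eq_sym (lft p)); case: (tpow_tail v == lft p); last first.
  by rewrite mulr0 !(mul0r, mulr0).
by case: (lab p == _); rewrite ?mul0r // mul1r mulr1 mulrA.
Qed.

(** [diag_coef w]: the coefficient of the associativity isomorphism
    V^n V -> V^(n+1) between [w] and the summand of V^n V which has the label
    of [w] and lies over the tpow_tail of [w]. *)
Definition diag_coef s n (w : ty_idx (T s n.+1)) : R[i] :=
  \sum_(p : ty_idx (ty_tens (T s n) (ty_simple s))
        | (lft p == tpow_tail w) && (lab p == lab w))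
      ty_entry (X := ty_tens (T s n) (ty_simple s)) (Y := T s n.+1)
        (assoc_pow (V s) n) p w.

Lemma fs_indicatorE s n :
  fs_indicator (V s) n.+1 =
  (piv_scalar tau s)^-1 *
    \sum_(w : ty_idx (T s n.+1) | lab w == Some 1%g) diag_coef w.
Proof.
rewrite mulr_sumr.
transitivity (\sum_(w : ty_idx (T s n.+1) | lab w == Some 1%g)
   ((piv_scalar tau s)^-1 *
    \sum_(p : ty_idx (ty_tens (T s n) (ty_simple s))
        | (lft p == tpow_tail w) && (lab p == Some 1%g))
      ty_entry (X := ty_tens (T s n) (ty_simple s)) (Y := T s n.+1)
        (assoc_pow (V s) n) p w)); last first.
  by apply: eq_bigr => w /eqP hw; rewrite /diag_coef hw.
pose M (v w : ty_idx (T s n.+1)) := (piv_scalar tau s)^-1 *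
    \sum_(p : ty_idx (ty_tens (T s n) (ty_simple s))
        | (lft p == tpow_tail v) && (lab p == Some 1%g))
      ty_entry (X := ty_tens (T s n) (ty_simple s)) (Y := T s n.+1)
        (assoc_pow (V s) n) p w.
apply: (end_trace_kernel (M := M)) => f w.
have [h|h] := eqVneq (lab w) (Some 1%g).
  by rewrite mul1r; exact: fs_rot_entry.
by rewrite mul0r ty_entry0 // eq_sym.
Qed.

Lemma diag_coef0 s (w : ty_idx (T s 1)) : diag_coef w = 1.
Proof.
rewrite /diag_coef.
have H : ty_fuses (lab (tt : ty_idx (ty_unit gT)))
    (lab (tt : ty_idx (ty_simple s))) s by rewrite ty_fuses_1l.
rewrite (big_only1 (chan H)).
- by rewrite [LHS]ty_entry_mor ifT // chanE; case: w.
- by rewrite !chanE !eqxx.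
move=> p np /andP[_ /eqP e]; case/negP: np; rewrite eq_chan e.
by case: (lft p) (rgt p) => [] []; rewrite !eqxx.
Qed.

Lemma diag_coef1 s (w : ty_idx (T s 2)) : diag_coef w = 1.
Proof.
rewrite /diag_coef (big_only1 w).
- by rewrite [LHS]ty_entry_id eqxx.
- by rewrite eqxx; case: (lft w) (tpow_tail w) => [] [].
move=> p np _; rewrite [LHS]ty_entry_id.
by move: np; case: eqP.
Qed.

(** Along the diagonal the intermediate summand of V^(n+1) V is forced to have
    the label of the tail of [w], so a single coefficient of the associativity
    appears. *)
Lemma diag_coefS s n (w : ty_idx (T s n.+3)) :
  diag_coef w =
  ty_F chi tau s (lab (tpow_tail (tpow_tail w))) s
      (lab (tpow_tail w)) (lab (tpow_tail w)) (lab w)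
    * diag_coef (tpow_tail w).
Proof.
have H : ty_fuses (lab (tpow_tail w)) (lab (tt : ty_idx (ty_simple s))) (lab w).
  by rewrite ty_fusesC; exact: (tpow_tailP w).
have [p [pl _ pw]] := chan_ex H.
rewrite {1}/diag_coef (big_only1 p); first last.
- move=> q /negP nq /andP[/eqP a /eqP b]; case: nq.
  by rewrite ty_chan_eqE a b pl pw !eqxx; case: (rgt p) (rgt q) => [] [].
- by rewrite pl pw !eqxx.
transitivity (\sum_(r : ty_idx (ty_tens (T s n.+1) (ty_simple s))
       | lft r == rgt (lft p))
     ty_F chi tau s (lab (lft r)) s (lab (lft p)) (lab r) (lab p)
       * ty_entry (X := ty_tens (T s n.+1) (ty_simple s)) (Y := T s n.+2)
           (assoc_pow (V s) n.+1) r (rgt w)).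
  exact: (@assoc_step R gT chi tau s (T s n.+1) (T s n.+2)
    (assoc_pow (V s) n.+1) p w pw).
rewrite pl pw /diag_coef mulr_sumr big_mkcond [RHS]big_mkcond.
apply: eq_bigr => r _.
have [a|_] := eqVneq (lft r) (tpow_tail (tpow_tail w)); last by [].
have [b|b] := eqVneq (lab r) (lab (tpow_tail w)); first by rewrite a b.
by rewrite ty_entry0 ?mulr0.
Qed.

Lemma sum_tpow s n (G : ty_idx (T s n.+1) -> ty_label gT -> R[i]) :
  \sum_(w : ty_idx (T s n.+2)) G (tpow_tail w) (lab w) =
  \sum_(w : ty_idx (T s n.+1)) \sum_(u | ty_fuses s (lab w) u) G w u.
Proof. exact: (@sum_simplel R gT s (T s n.+1)). Qed.

Lemma lab_tpow_inv a n (w : ty_idx (T (Some a) n)) : lab w = Some (a ^+ n)%g.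
Proof.
elim: n w => [//|n IH] w.
have := tpow_tailP w; rewrite IH expgS.
by case: (lab w) => //= c /eqP ->.
Qed.

Lemma sum_tpow_inv a n (G : ty_label gT -> R[i]) :
  \sum_(w : ty_idx (T (Some a) n.+1)) G (lab w) = G (Some (a ^+ n.+1)%g).
Proof.
elim: n G => [|n IH] G; first by rewrite (big_only1 tt) // expg1.
rewrite (sum_tpow (fun _ u => G u)).
rewrite (IH (fun v => \sum_(u | ty_fuses (Some a) v u) G u)).
rewrite (big_only1 (Some (a ^+ n.+2)%g)).
- by [].
- by rewrite /= -expgS eqxx.
by move=> [c|] // nc /eqP ec; case/eqP: nc; rewrite ec -expgS.
Qed.

Lemma diag_coef_inv a n (w : ty_idx (T (Some a) n.+1)) : diag_coef w = 1.
Proof.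
elim: n w => [|[|n] IH] w; [exact: diag_coef0|exact: diag_coef1|].
by rewrite diag_coefS IH !lab_tpow_inv mulr1.
Qed.

Lemma fs_indicator_inv a n :
  fs_indicator (V (Some a)) n.+1 = ((a ^+ n.+1)%g == 1%g)%:R.
Proof.
rewrite fs_indicatorE invr1 mul1r.
under eq_bigr => w _ do rewrite diag_coef_inv.
rewrite big_mkcond (sum_tpow_inv a n (fun u => if u == Some 1%g then 1 else 0)).
by rewrite (inj_eq Some_inj); case: eqP.
Qed.

Lemma lab_tpow_m n (w : ty_idx (T None n)) : isSome (lab w) = ~~ odd n.
Proof.
elim: n w => [//|n IH] w.
have := tpow_tailP w; rewrite /= -(IH (tpow_tail w)).
by case: (lab (tpow_tail w)) (lab w) => [a|] [b|].
Qed.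

Lemma fs_indicator_m_odd n : fs_indicator (V None) n.*2.+1 = 0.
Proof.
rewrite fs_indicatorE big1 ?mulr0 // => w /eqP e.
by have := lab_tpow_m w; rewrite e /= odd_double.
Qed.

End Powers.

(** * Indicators of m in even degree *)

Section Transfer.
Local Open Scope complex_scope.
Variables (R : realType) (gT : finGroupType).
Variables (chi : gT -> gT -> R[i]) (tau : R).
Hypothesis abelian_gT : abelian [set: gT].
Hypothesis chi_bichar : bicharacter chi.
Hypothesis tau0 : tau != 0.
Local Notation lab := ty_lab.
Local Notation C := (ty_pivotal chi tau).
Local Notation V s := (ty_simple s : obj C).
Local Notation T s n := (@tpow _ C (ty_simple s) n : ty_obj gT).

Lemma lab_m_odd n (w : ty_idx (T None n)) : odd n -> lab w = None.
Proof. by move=> on; have := lab_tpow_m w; rewrite on; case: (lab w). Qed.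

Lemma lab_m_even n (w : ty_idx (T None n)) :
  ~~ odd n -> exists x, lab w = Some x.
Proof.
by move=> on; have := lab_tpow_m w; rewrite on; case: (lab w) => // x; exists x.
Qed.

(** The sum of the diagonal coefficients over the summands of m^(2k+2) of label
    [y], computed by a transfer matrix ([sum_diag_coef]). *)
Fixpoint transfer_coef k (y : gT) : R[i] :=
  if k is k'.+1 then
    tau%:C * \sum_x chi x y * (chi x x)^-1 * transfer_coef k' x
  else 1.

Lemma sum_diag_coef k y :
  \sum_(w : ty_idx (T None k.*2.+2) | lab w == Some y) diag_coef w =
  transfer_coef k y.
Proof.
elim: k y => [|k IH] y.
  under eq_bigr => w _ do rewrite diag_coef1.
  rewrite big_mkcond (sum_tpow (fun _ u => if u == Some y then 1 else 0)).
  rewrite (big_only1 tt) //.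
  rewrite (big_only1 (Some y)) ?eqxx // => u.
  by move=> /negbTE->.
rewrite doubleS.
(* Two tensor factors are removed in turn: the first contributes chi x y, the
   second tau / chi x x, where x is the label two steps down. *)
pose c (u : ty_label gT) := if u is Some x then chi x y else 1.
pose G1 (w : ty_idx (T None k.*2.+3)) u :=
  if u == Some y then c (lab (tpow_tail w)) * diag_coef w else 0.
pose G2 (w : ty_idx (T None k.*2.+2)) (u : ty_label gT) :=
  c (lab w) * (ty_F chi tau None (lab (tpow_tail w)) None (lab w) (lab w) u
     * diag_coef w).
transitivity (\sum_(w : ty_idx (T None k.*2.+4)) G1 (tpow_tail w) (lab w)).
  rewrite big_mkcond; apply: eq_bigr => w _; rewrite /G1.
  case: eqP => // e; rewrite [LHS](diag_coefS abelian_gT) // e.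
  congr (_ * _); have := tpow_tailP w; rewrite e.
  have := tpow_tailP (tpow_tail w).
  have [|x ->] := @lab_m_even _ (tpow_tail (tpow_tail w)).
    by rewrite /= odd_double.
  by case: (lab (tpow_tail w)).
rewrite sum_tpow.
transitivity (\sum_(w : ty_idx (T None k.*2.+3)) G2 (tpow_tail w) (lab w)).
  apply: eq_bigr => w _.
  have e : lab w = None.
    by apply: lab_m_odd; rewrite /= odd_double.
  rewrite e (big_only1 (Some y)) //.
    by rewrite /G1 /G2 eqxx [X in _ * X](diag_coefS abelian_gT) // e.
  by move=> u /negbTE nu _; rewrite /G1 nu.
rewrite sum_tpow.
pose l (w : ty_idx (T None k.*2.+2)) := odflt 1%g (lab w).
have lE w : lab w = Some (l w).
  by rewrite /l; case: (@lab_m_even _ w) => [|x ->]; rewrite /= ?odd_double.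
transitivity (\sum_x tau%:C * (chi x y * (chi x x)^-1 * transfer_coef k x));
  last by rewrite -mulr_sumr.
rewrite (partition_big l xpredT) //; apply: eq_bigr => x _.
rewrite -IH mulr_sumr mulr_sumr; apply: eq_big => [w|w /andP[_ /eqP e]].
  by rewrite lE (inj_eq Some_inj).
rewrite (big_only1 None); first last.
- by case=> // z _; rewrite lE.
- by rewrite lE.
rewrite /G2 lE e.
have := tpow_tailP w; rewrite lE e; case: (lab (tpow_tail w)) => // _.
by move: (diag_coef w) => d; rewrite /= -!mulrA mulrCA.
Qed.

Lemma fs_indicator_m_even k :
  fs_indicator (V None) k.+1.*2 = (Num.sg tau)%:C^-1 * transfer_coef k 1%g.
Proof. by rewrite doubleS fs_indicatorE // sum_diag_coef. Qed.

End Transfer.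

(** * Total indicators and divisibility *)

Section Totals.
Local Open Scope complex_scope.
Variables (R : realType) (gT : finGroupType).
Variables (chi : gT -> gT -> R[i]) (tau : R).
Hypothesis abelian_gT : abelian [set: gT].
Hypothesis chi_bichar : bicharacter chi.
Hypothesis chi_sym : bichar_symmetric chi.
Hypothesis chi_nondeg : bichar_nondegenerate chi.
Hypothesis tau_sq : tau ^+ 2 = #|gT|%:R^-1.
Local Notation C := (TY chi tau).
Local Notation N := #|gT|.

Lemma tau_neq0 : tau != 0.
Proof.
apply: contraTneq (finGroup_card_neq0 R gT) => t0.
by move: tau_sq; rewrite t0 expr0n => /esym/eqP; rewrite invr_eq0 => ->.
Qed.

Lemma tauC_sq : (tau%:C) ^+ 2 = N%:R^-1.
Proof. by rewrite -rmorphXn /= tau_sq fmorphV rmorph_nat. Qed.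

Lemma fs_totalE n : (0 < n)%N ->
  fs_total C n = (torsion gT n)%:R +
    fs_indicator (ty_simple None : obj (ty_pivotal chi tau)) n * `|tau|^-1%:C.
Proof.
case: n => // n _; rewrite /fs_total (bigD1 None) //= addrC.
rewrite ty_pdimE ?tau_neq0 //.
congr (_ + _); rewrite (reindex_omap Some id) /=; last by case.
rewrite (eq_bigr (fun a => if (a ^+ n.+1 == 1)%g then 1 else 0)) => [|a _].
  rewrite -big_mkcondr /= sumr_const; congr (_ *+ _).
  by apply: eq_card => a; rewrite !inE unfold_in eqxx.
rewrite ty_pdimE ?tau_neq0 // mulr1.
rewrite (fs_indicator_inv abelian_gT chi_bichar tau_neq0).
by case: eqP.
Qed.

Lemma fs_total_odd n : odd n -> fs_total C n = (torsion gT n)%:R.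
Proof.
move=> on; rewrite fs_totalE ?odd_gt0 // -[n]odd_double_half on add1n.
by rewrite (fs_indicator_m_odd chi_bichar tau_neq0) mul0r addr0.
Qed.

Lemma fs_total_even k : fs_total C (k.+1 * 2) =
  (torsion gT (k.+1 * 2))%:R + (tau%:C)^-1 * transfer_coef chi tau k 1%g.
Proof.
rewrite fs_totalE ?muln_gt0 // {2}muln2.
rewrite (fs_indicator_m_even abelian_gT chi_bichar tau_neq0).
congr (_ + _); rewrite mulrAC -!fmorphV -rmorphM /=; congr (_%:C * _).
by rewrite -invfM -numEsg.
Qed.

Section Odd.
Hypothesis odd_gT : odd N.

(* As |A| is odd, (|A| + 1)/2 is an inverse of 2 modulo |A|, so that q is a
   square root of the diagonal of beta. *)
Let beta a b := (chi a b)^-1.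
Let q a := (chi a a)^-1 ^+ N.+1./2.

Let beta_bichar : bicharacter beta.
Proof.
split=> [a b|a b c|a b c]; first by rewrite invr_eq0 bichar_neq0.
  by rewrite /beta (bicharMl chi_bichar) invfM.
by rewrite /beta (bicharMr chi_bichar) invfM.
Qed.

Let beta_sym : bichar_symmetric beta.
Proof. by move=> a b; rewrite /beta chi_sym. Qed.

Let beta_nondeg : bichar_nondegenerate beta.
Proof.
move=> a ha; apply: chi_nondeg => x.
by apply: invr_inj; rewrite invr1; exact: ha.
Qed.

Let qM a b : q (a * b)%g = q a * q b * beta a b.
Proof.
have bX x y : (beta x y ^+ 2) ^+ N.+1./2 = beta x y.
  rewrite -exprM mul2n -[N.+1./2.*2]addn0 -[0%N]/(false : nat).
  have -> : (false = odd N.+1 :> bool) by rewrite /= odd_gT.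
  by rewrite addnC odd_double_half exprS (bichar_unity beta_bichar) mulr1.
rewrite -[X in _ = _ * X]bX -!exprMn; congr (_ ^+ _).
rewrite -!/(beta _ _) (bicharMl beta_bichar) !(bicharMr beta_bichar).
by rewrite (beta_sym b a); ring.
Qed.

Let qV a : q a^-1%g = q a.
Proof. by rewrite /q (bicharVl chi_bichar) (bicharVr chi_bichar) invrK. Qed.

Let q_unity a : q a ^+ N = 1.
Proof.
by rewrite /q -exprM mulnC exprM exprVn (bichar_unity chi_bichar) invr1 expr1n.
Qed.

Let w := tau%:C * gauss_sum q.

Lemma fs_total_even_gauss k : exists2 z : R[i], algebraic_integer z &
  fs_total C (k.+1 * 2) =
   (torsion gT k.+1)%:R * (1 + w ^+ k.+1 * (1 + 2%:R * z)).
Proof.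
have [z iz sz] :=
  sum_quadVX abelian_gT beta_bichar beta_sym qM qV q_unity k.+1 odd_gT.
exists z => //; rewrite fs_total_even torsion_double // mulrDr mulr1.
congr (_ + _).
rewrite mulrCA -sz.
have t0 y : transfer_coef chi tau 0 y = 1 by [].
have tS k' y : transfer_coef chi tau k'.+1 y =
     tau%:C * \sum_x (beta x y)^-1 * beta x x * transfer_coef chi tau k' x.
  by rewrite /=; congr (_ * _); apply: eq_bigr => x _; rewrite /beta invrK.
have := transfer_iter beta_bichar beta_sym beta_nondeg qM qV q_unity t0 tS
  k 1%g.
rewrite (quad1 beta_bichar qM q_unity) invr1 mulr1 => E.
have N0 : N%:R != 0 :> R[i] := finGroup_card_neq0 _ gT.
have tC0 : tau%:C != 0 :> R[i] by rewrite fmorph_eq0 tau_neq0.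
have -> : transfer_coef chi tau k 1%g =
    tau%:C ^+ 2 * (N%:R * transfer_coef chi tau k 1%g).
  by rewrite tauC_sq mulKf.
rewrite E /w exprMn [tau%:C ^+ k.+1]exprS.
have -> : \sum_b (q b)^-1 ^+ k.+1 * beta b 1%g = \sum_b (q b)^-1 ^+ k.+1.
  by apply: eq_bigr => b _; rewrite (bichar1r beta_bichar) mulr1.
by field.
Qed.

Lemma frobenius_holds_mod4_1 : N = 1 %[mod 4] -> frobenius_holds C.
Proof.
move=> N1; exists (2 * N)%N; split=> [||n n0 nN].
- by rewrite muln_gt0 finGroup_card_gt0.
- exact: ty_global_dimE.
have quot m k : (0 < k)%N -> (k %| m)%N -> m%:R / k%:R = (m %/ k)%:R :> R[i].
  by move=> k0 km; rewrite -{1}(divnK km) natrM mulfK // pnatr_eq0 -lt0n.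
have [on|en] := boolP (odd n).
  have nN' : (n %| N)%N by rewrite -(@Gauss_dvdr n 2) // coprimen2.
  rewrite fs_total_odd // quot ?torsion_dvd //; exact: algint_nat.
have [k nE] : exists k, n = (k.+1 * 2)%N.
  exists n./2.-1; rewrite prednK ?muln2; first by rewrite even_halfK.
  by rewrite half_gt0; case: n n0 en nN => [|[|n]].
have kN : (k.+1 %| N)%N by move: nN; rewrite nE mulnC dvdn_pmul2l.
have ok : odd k.+1 by apply: dvdn_odd kN odd_gT.
have [z iz E] := fs_total_even_gauss k; rewrite {1}nE E.
have iw := normalized_gauss_sum_X_half beta_bichar beta_sym beta_nondeg
  qM qV q_unity tauC_sq ok N1.
have ik := torsion_dvd kN.
have -> : (torsion gT k.+1)%:R * (1 + w ^+ k.+1 * (1 + 2%:R * z)) / n%:R =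
   (torsion gT k.+1 %/ k.+1)%:R * ((1 + w ^+ k.+1) / 2%:R + w ^+ k.+1 * z).
  rewrite -quot // nE natrM.
  have k0 : k.+1%:R != 0 :> R[i] by rewrite pnatr_eq0.
  by move: (k.+1%:R) k0 (w ^+ k.+1) => c c0 x; field.
apply: algintM; first exact: algint_nat.
apply: algintD => //; apply: algintM => //.
have -> : w ^+ k.+1 = (1 + w ^+ k.+1) / 2%:R * 2%:R - 1.
  by rewrite divfK ?pnatr_eq0 // addrC addKr.
apply: algintB; last exact: algint1.
by apply: algintM => //; exact: algint_nat.
Qed.

End Odd.

Lemma fs_total2_mod4_3 : N = 3 %[mod 4] ->
  ~ algebraic_integer (fs_total C 2 / 2%:R).
Proof.
move=> N3; have odd_gT : odd N by rewrite (divn_eq N 4) N3 oddD oddM andbF.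
have t1 : torsion gT (1 * 2) = 1%N.
  by rewrite torsion_double // torsion1.
rewrite (fs_total_even 0 : fs_total C 2 = _) t1 mulr1.
set x := (tau%:C)^-1 => iz.
have x2 : x ^+ 2 = N%:R by rewrite exprVn tauC_sq invrK.
have NE : N%:R = 4%:R * (N %/ 4)%:R + 3%:R :> R[i].
  by rewrite {1}(divn_eq N 4) N3 natrD natrM mulrC.
apply: (@half_not_algint R[i]).
set z := (1 + x) / 2%:R in iz.
have -> : 2%:R^-1 = z ^+ 2 - z - (N %/ 4)%:R.
  have -> : z ^+ 2 - z = (x ^+ 2 - 1) / 4%:R by rewrite /z; field.
  by rewrite x2 NE; field.
apply: algintB; last exact: algint_nat.
by apply: algintB => //; apply: algintX.
Qed.

Lemma frobenius_fails_mod4_3 : N = 3 %[mod 4] -> ~ frobenius_holds C.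
Proof.
move=> N3 [M [M0 gM fM]]; apply: (fs_total2_mod4_3 N3); apply: fM => //.
move: gM; rewrite ty_global_dimE // => /eqP; rewrite eqr_nat => /eqP <-.
exact: dvdn_mulr.
Qed.

End Totals.

Theorem theorem4p4 (R : realType) (gT : finGroupType)
    (abelian_gT : abelian [set: gT])
    (chi : gT -> gT -> R[i]) (tau : R)
    (chi_bichar : bicharacter chi)
    (chi_sym : bichar_symmetric chi)
    (chi_nondeg : bichar_nondegenerate chi)
    (tau_sq : tau ^+ 2 = #|gT|%:R^-1) :
  (#|gT| = 1 %[mod 4] -> frobenius_holds (TY chi tau)) /\
  (#|gT| = 3 %[mod 4] ->
     ~ frobenius_holds (TY chi tau) /\
     ~ algebraic_integer (fs_total (TY chi tau) 2 / 2%:R)).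
Proof.
split=> [N1|N3].
  apply: frobenius_holds_mod4_1 => //.
  by rewrite (divn_eq #|gT| 4) N1 oddD oddM andbF.
by split; [exact: frobenius_fails_mod4_3|exact: fs_total2_mod4_3].
Qed.
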